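(* Let $1\le m\le n-1$ be integers, let $A\subset\mathbb R^n$ be Borel measurable and let $\mathbf W_0: A\to\mathbb G(n,m)$ be Lipschitzian. For $x\in A$ put $\mathbf W(x)=x+\mathbf W_0(x)$. Then $$\limsup_{r\to0^+}\frac{\mathcal H^m\left(A\cap \mathbf B(x,r)\cap\mathbf W(x)\right)}{\alpha(m)r^m}\ge\frac1{2^n}$$ for $\mathcal L^n$-almost every $x\in A$.
   Context: $\mathbb G(n,m)$ is the set of $m$-dimensional vector subspaces of $\mathbb R^n$, with the metric $d(W_1,W_2)=\|P_{W_1}-P_{W_2}\|$ (operator norm), where $P_W$ is the orthogonal projection of $\mathbb R^n$ onto $W$. $\mathcal L^n$ is Lebesgue (outer) measure, $\mathcal H^m$ is $m$-dimensional Hausdorff (outer) measure normalized so that it coincides with Lebesgue measure on $m$-dimensional affine subspaces, $\alpha(m)=\mathcal L^m$ of the unit ball of $\mathbb R^m$, and $\mathbf B(x,r)$ is the closed Euclidean ball. *)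

(* Defs.v *)
From HB Require Import structures.
From mathcomp Require Import all_boot all_order all_algebra.
From mathcomp Require Import all_classical all_reals all_analysis.

Set Implicit Arguments.
Unset Strict Implicit.
Unset Printing Implicit Defensive.

Import Order.TTheory GRing.Theory Num.Theory.
Import numFieldNormedType.Exports.

Local Open Scope classical_set_scope.
Local Open Scope ring_scope.

(* The norm that the library puts on 'rV[R]_n is the sup norm, hence a
   separate Euclidean structure.  The library topology is the usual one. *)
Definition dotv (R : realType) (n : nat) (x y : 'rV[R]_n) : R :=
  \sum_(i < n) x 0 i * y 0 i.

Definition enorm (R : realType) (n : nat) (x : 'rV[R]_n) : R :=
  Num.sqrt (dotv x x).

Definition cball (R : realType) (n : nat) (x : 'rV[R]_n) (r : R) :
    set 'rV[R]_n :=
  [set y | enorm (y - x) <= r].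

Definition borel (R : realType) (n : nat) (A : set 'rV[R]_n) : Prop :=
  <<s (open : set (set 'rV[R]_n)) >> A.

Definition box (R : realType) (n : nat) (a b : 'rV[R]_n) : set 'rV[R]_n :=
  [set x | forall i, a 0 i <= x 0 i <= b 0 i].

Definition box_volume (R : realType) (n : nat) (a b : 'rV[R]_n) : R :=
  \prod_(i < n) (b 0 i - a 0 i).

Definition lebesgue_outer (R : realType) (n : nat) (S : set 'rV[R]_n) :
    \bar R :=
  ereal_inf [set s : \bar R | exists a b : nat -> 'rV[R]_n,
    [/\ forall k i, a k 0 i <= b k 0 i,
        S `<=` \bigcup_k box (a k) (b k) &
        s = (\sum_(0 <= k <oo) (box_volume (a k) (b k))%:E)%E]].

Definition alpha (R : realType) (m : nat) : R :=
  fine (lebesgue_outer (cball (0 : 'rV[R]_m) 1)).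

(* The point 0 is added because the supremum of the empty set is -oo. *)
Definition diam (R : realType) (n : nat) (C : set 'rV[R]_n) : \bar R :=
  ereal_sup (0%E |` [set s : \bar R | exists x y, [/\ C x, C y &
                                s = (enorm (x - y))%:E]]).

(* For m = 0 the empty set contributes 0 ^+ 0 = 1: meant for 0 < m only. *)
Definition hausdorff_delta (R : realType) (m n : nat) (delta : R)
    (S : set 'rV[R]_n) : \bar R :=
  ereal_inf [set s : \bar R | exists C : nat -> set 'rV[R]_n,
    [/\ forall k, (diam (C k) <= delta%:E)%E,
        S `<=` \bigcup_k C k &
        s = (\sum_(0 <= k <oo) diam (C k) ^+ m)%E]].

Definition hausdorff_raw (R : realType) (m n : nat) (S : set 'rV[R]_n) :
    \bar R :=
  ereal_sup [set hausdorff_delta m delta S | delta in [set d : R | 0 < d]].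

(* The factor for which hausdorff m agrees with Lebesgue measure on
   m-dimensional affine subspaces.  On these, hausdorff_raw m is invariant under
   isometries, hence one and the same positive finite multiple of Lebesgue
   measure; the multiple is read off on [0, 1]^m, whose Lebesgue measure is 1. *)
Definition hausdorff_const (R : realType) (m : nat) : R :=
  (fine (hausdorff_raw m (box (const_mx 0 : 'rV[R]_m) (const_mx 1))))^-1.

Definition hausdorff (R : realType) (m n : nat) (S : set 'rV[R]_n) : \bar R :=
  ((hausdorff_const R m)%:E * hausdorff_raw m S)%E.

Definition grassmannian (R : realType) (n m : nat) :
    set {vspace 'rV[R]_n} :=
  [set W | (\dim W = m)%N].
Arguments grassmannian {R} n m _.

(* xget picks the unique element of the set, with default 0 *)
Definition orthoproj (R : realType) (n : nat) (W : {vspace 'rV[R]_n})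
    (x : 'rV[R]_n) : 'rV[R]_n :=
  xget 0 [set p | p \in W /\ forall w, w \in W -> dotv (x - p) w = 0].

Definition opnorm (R : realType) (n : nat) (f : 'rV[R]_n -> 'rV[R]_n) : R :=
  sup [set enorm (f x) | x in cball (0 : 'rV[R]_n) 1].

Definition grass_dist (R : realType) (n : nat) (W1 W2 : {vspace 'rV[R]_n}) :
    R :=
  opnorm (fun x => orthoproj W1 x - orthoproj W2 x).

Definition grass_lipschitz (R : realType) (n : nat) (A : set 'rV[R]_n)
    (W : 'rV[R]_n -> {vspace 'rV[R]_n}) : Prop :=
  exists K : R, forall x y, A x -> A y ->
    grass_dist (W x) (W y) <= K * enorm (x - y).

Definition affine_subspace (R : realType) (n : nat) (x : 'rV[R]_n)
    (W : {vspace 'rV[R]_n}) : set 'rV[R]_n :=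
  [set x + w | w in [set w | w \in W]].

(* Main.v *)
(* For t in the unit ball of R^m put Phi_t(x) = x + r F(x, t), where F(x, .) is a
   linear parametrization of W0 x, Lipschitz in x and within a factor 2 of an
   isometry.  On a compact subset G of A and for r small, Phi_t is a Lipschitz
   perturbation of the identity, so Phi_t^-1 enlarges Lebesgue outer measure by
   at most a constant factor; as Phi_t maps G into a neighbourhood U of G with
   U \ G of small measure, Phi_t(x) lies in G for all x in G outside a small set.
   By Fubini and Markov, all x in G outside a small set satisfy Phi_t(x) in G for
   at least half of the t in the ball, and for these x the ratio at the scale r
   is at least 2^-(m+1) >= 2^-n.  Since r may be taken arbitrarily small, the
   points of G whose ratio is < 2^-n at all scales below some 1/j form a null
   set.  Hausdorff measure enters only through H^m >= L^m on R^m, which follows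
   from H^m <= L^m by taking complements in a cube. *)
From HB Require Import structures.
Require Import Defs.
From mathcomp Require Import all_boot all_order all_algebra.
From mathcomp Require Import all_classical all_reals all_analysis.
From mathcomp Require Import measurable_realfun ring lra.
Set Implicit Arguments.
Unset Strict Implicit.
Unset Printing Implicit Defensive.
Import Order.TTheory GRing.Theory Num.Theory.
Import numFieldNormedType.Exports.
Local Open Scope classical_set_scope.
Local Open Scope ring_scope.

(** * Lebesgue outer measure *)

(** The quantifiers come in the order e, U, r: the error allowed for the exceptional set dictates
    how small U \ G must be, and only then is r chosen, small enough for Phi_t to map G into U. The
    bad points for a given j are tested at this single r, and e is arbitrary, so the crude factor
    (4n)^n of the volume estimate is harmless. Only 2^-n is tight: the distortion of F costs 2^-m,
    Markov's inequality 1/2, and m + 1 <= n. F is built where W_0 stays within 1/2 of a fixed plane,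
    hence the cutting of space into cubes of side 1/(2Kn). F is known to be Lipschitz in x only over
    A, so the joint measurability that Fubini requires is obtained over G: since G is closed and Phi
    is continuous over it, leaving G is a relatively open condition on (x, t). Dimensions are mostly
    written [n.+1] and [m.+1]; [m < n] then encodes the bound m <= n - 1 on the true dimensions. *)

Section covering_infimum.
Context (R : realType) (T I : Type).
Variables (adm : I -> Prop) (piece : I -> set T) (weight : I -> \bar R).
Local Open Scope ereal_scope.

(** Method I construction of outer measures. Lebesgue outer measure (boxes) and the Hausdorff
    premeasures (sets of bounded diameter) are both instances, so countable subadditivity is proved
    once. *)
Definition cover_inf (S : set T) : \bar R :=
  ereal_inf [set s : \bar R | exists p : nat -> I,
    [/\ forall k, adm (p k), S `<=` \bigcup_k piece (p k) &
        s = \sum_(0 <= k <oo) weight (p k)]].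

Hypothesis weight_ge0 : forall i, adm i -> 0 <= weight i.

Lemma cover_inf_ge0 S : 0 <= cover_inf S.
Proof.
apply: le_ereal_inf_tmp => x [p [pa _ ->]].
by apply: nneseries_ge0 => k _ _; exact: weight_ge0.
Qed.

Lemma le_cover_inf : {homo cover_inf : A B / A `<=` B >-> A <= B}.
Proof.
move=> A B AB; apply: ereal_inf_le_tmp => x [p [pa Bp ->]].
by exists p; split=> //; exact: subset_trans Bp.
Qed.

(** Cover each [A n] within [e / 2 ^ n.+1] of its infimum, then list the doubly indexed pieces
    through a bijection of [nat] with [nat * nat]. *)
Lemma cover_inf_sigma_subadditive : sigma_subadditive cover_inf.
Proof.
move=> A; have [[i ioo]|] := pselect (exists i, cover_inf (A i) = +oo).
  rewrite (eseries_pinfty _ _ ioo) ?leey// => n _.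
  by rewrite -ltNye (lt_le_trans _ (cover_inf_ge0 _)).
rewrite -forallNE => Aoo.
apply/lee_addgt0Pr => e e0.
rewrite (le_trans _ (epsilon_trick _ _ (ltW e0)))//; last first.
  by move=> n; exact: cover_inf_ge0.
have cover n : exists p : nat -> I, [/\ forall k, adm (p k),
    A n `<=` \bigcup_k piece (p k) &
    \sum_(0 <= k <oo) weight (p k) <= cover_inf (A n) + (e / (2 ^ n.+1)%:R)%:E].
  have en : (0 < e / (2 ^ n.+1)%:R)%R by rewrite divr_gt0// ltr0n expn_gt0.
  have fin : cover_inf (A n) \is a fin_num.
    by rewrite ge0_fin_numE ?cover_inf_ge0// ltey; exact/eqP/Aoo.
  have [x [p [pa Ap ->]] px] := lb_ereal_inf_adherent en fin.
  by exists p; split=> //; exact: ltW px.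
have [G PG] := choice cover.
have wG x : 0 <= (weight \o uncurry G) x.
  by apply: weight_ge0; case: x => i j /=; case: (PG i) => + _ _; apply.
apply: (@le_trans _ _ (\esum_(i in setT) (weight \o uncurry G) i)).
  apply: ereal_inf_lbound => /=.
  have /card_esym/ppcard_eqP[f] := card_nat2.
  exists (uncurry G \o f); split=> [k /=| |].
  - by case: (f k) => i j /=; case: (PG i) => + _ _; apply.
  - move=> t [i _ Ait]; have [_ /(_ _ Ait)[j _ ?] _] := PG i.
    by exists (f^-1%FUN (i, j)) => //=; rewrite invK ?inE.
  - rewrite nneseries_esumT; last by move=> k; exact: wG.
    exact: (reindex_esum setT setT f).
rewrite (_ : esum _ _ = \sum_(i <oo) \sum_(j <oo) weight (G i j)).
  apply: lee_nneseries => [i _ _|i _]; last by case: (PG i).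
  by apply: nneseries_ge0 => j _ _; exact: (wG (i, j)).
rewrite nneseries_esumT; last first.
  by move=> i; apply: nneseries_ge0 => j _ _; exact: (wG (i, j)).
transitivity (\esum_(i in [set: nat]) \esum_(j in [set: nat]) weight (G i j)).
  rewrite esum_esum; last by move=> i j _ _; exact: (wG (i, j)).
  rewrite (_ : setT `*`` _ = setT); last by rewrite predeqE.
  by apply: eq_esum => -[].
by apply: eq_esum => i _; rewrite nneseries_esumT// => j; exact: (wG (i, j)).
Qed.

End covering_infimum.

Section lebesgue_outer_measure.
Context (R : realType) (n : nat).
Local Open Scope ereal_scope.
Local Notation V := 'rV[R]_n.+1.

Definition ordered_corners (p : V * V) : Prop :=
  forall i, (p.1 0 i <= p.2 0 i)%R.

Lemma box_volume_ge0 k (a b : 'rV[R]_k) :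
  (forall i, (a 0 i <= b 0 i)%R) -> (0 <= box_volume a b)%R.
Proof. by move=> ab; apply: prodr_ge0 => i _; rewrite subr_ge0. Qed.

Lemma lebesgue_outerE (S : set V) : lebesgue_outer S =
  cover_inf ordered_corners (fun p => box p.1 p.2)
    (fun p => (box_volume p.1 p.2)%:E) S.
Proof.
congr ereal_inf; apply/seteqP; split=> s /=.
- by move=> [a [b [ab Sab ->]]]; exists (fun k => (a k, b k)).
- by move=> [p [pa Sp ->]]; exists (fst \o p), (snd \o p); split=> // k i; exact: pa.
Qed.

Let weight_ge0 (p : V * V) : ordered_corners p -> 0 <= (box_volume p.1 p.2)%:E.
Proof. by move=> pa; rewrite lee_fin; exact: box_volume_ge0. Qed.

Lemma lebesgue_outer_ge0 (S : set V) : 0 <= lebesgue_outer S.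
Proof. by rewrite lebesgue_outerE; exact: cover_inf_ge0. Qed.

Lemma le_lebesgue_outer :
  {homo (@lebesgue_outer R n.+1) : A B / A `<=` B >-> A <= B}.
Proof. by move=> A B AB; rewrite !lebesgue_outerE; exact: le_cover_inf. Qed.

Lemma lebesgue_outer_sigma_subadditive :
  sigma_subadditive (@lebesgue_outer R n.+1).
Proof.
move=> F; rewrite lebesgue_outerE; under eq_eseriesr do rewrite lebesgue_outerE.
exact: cover_inf_sigma_subadditive.
Qed.

Lemma lebesgue_outer_box_le (a b : V) : (forall i, (a 0 i <= b 0 i)%R) ->
  lebesgue_outer (box a b) <= (box_volume a b)%:E.
Proof.
move=> ab; apply: ereal_inf_lbound.
(* The other pieces are the degenerate [box a a], of volume 0 because the dimension is positive. *)
exists (fun=> a), (fun k => if k is 0%N then b else a).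
split=> [[|k] i//|x abx|]; first by exists 0%N.
rewrite nneseries_recl//; last first.
  by move=> [|k] _; rewrite lee_fin box_volume_ge0.
rewrite eseries_cond/= eseries0 ?adde0// => -[|k]//= _ _.
by rewrite /box_volume big_ord_recl subrr mul0r.
Qed.

Lemma lebesgue_outer_set0 : lebesgue_outer (set0 : set V) = 0.
Proof.
apply/eqP; rewrite eq_le lebesgue_outer_ge0 andbT.
have -> : 0 = (box_volume (0 : V) 0)%:E.
  by rewrite /box_volume big_ord_recl subrr mul0r.
apply: le_trans (lebesgue_outer_box_le _) => //.
by apply: le_lebesgue_outer => x [].
Qed.

HB.instance Definition _ := isOuterMeasure.Build R V (@lebesgue_outer R n.+1)
  lebesgue_outer_set0 lebesgue_outer_ge0 le_lebesgue_outer
  lebesgue_outer_sigma_subadditive.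

End lebesgue_outer_measure.

(** * Volume of a box *)

Section box_volume_lower_bound.
Context (R : realType).
Local Open Scope ereal_scope.

Let itv_indic (a b : R) : R -> R := \1_([set` `[a, b]%R] : set R).

Let itv_indic_ge0 a b x : (0 <= itv_indic a b x)%R.
Proof. by rewrite /itv_indic indicE. Qed.

Let integral_itv_indic (c a b : R) : (a <= b)%R -> (0 <= c)%R ->
  \int[lebesgue_measure]_x (c * itv_indic a b x)%:E = (c * (b - a))%:E.
Proof.
move=> ab c0; under eq_integral do rewrite EFinM.
rewrite ge0_integralZl_EFin//; last 2 first.
- by move=> x _; rewrite lee_fin.
- by apply/measurable_EFinP; exact: measurable_indic.
rewrite integral_indic// setIT.
rewrite [X in _ * X](lebesgue_measure_itv `[a, b]%R)/= lte_fin.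
case: ltP => [_|ba]; first by rewrite -EFinB -EFinM.
by have -> : a = b; [exact/le_anti/andP|rewrite subrr mulr0 mule0].
Qed.

(** An inequality between indicators is integrated one coordinate at a time, monotone convergence
    taking care of infinite covers. The weights [v] and [w] serve the induction, and points are
    sequences [nat -> R] so that [d] can vary. *)
Lemma prod_itv_indic_le (d : nat) (v : R) (a b : nat -> R)
    (w : nat -> R) (A B : nat -> nat -> R) :
  (0 <= v)%R -> (forall i, a i <= b i)%R ->
  (forall k, 0 <= w k)%R -> (forall k i, A k i <= B k i)%R ->
  (forall x : nat -> R, (v * \prod_(i < d) itv_indic (a i) (b i) (x i))%:E <=
    \sum_(0 <= k <oo)
      (w k * \prod_(i < d) itv_indic (A k i) (B k i) (x i))%:E) ->
  (v * \prod_(i < d) (b i - a i))%:E <=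
    \sum_(0 <= k <oo) (w k * \prod_(i < d) (B k i - A k i))%:E.
Proof.
elim: d => [|d IH] in v w *.
  move=> _ _ _ _ /(_ (fun=> 0%R)); rewrite !big_ord0.
  by under eq_eseriesr do rewrite big_ord0; under [in X in _ -> X]eq_eseriesr do rewrite big_ord0.
move=> v0 ab w0 AB H.
pose P := (\prod_(i < d) (b i - a i))%R.
pose Q k := (\prod_(i < d) (B k i - A k i))%R.
have P0 : (0 <= P)%R by apply: prodr_ge0 => i _; rewrite subr_ge0.
have Q0 k : (0 <= Q k)%R by apply: prodr_ge0 => i _; rewrite subr_ge0.
(* With the last coordinate frozen at [y], its indicators join the weights and the induction
   hypothesis integrates out the others. *)
have slice y : (v * P * itv_indic (a d) (b d) y)%:E <=
    \sum_(0 <= k <oo) (w k * Q k * itv_indic (A k d) (B k d) y)%:E.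
  rewrite mulrAC; under eq_eseriesr do rewrite mulrAC.
  apply: IH => //.
  - by rewrite mulr_ge0.
  - by move=> k; rewrite mulr_ge0.
  move=> x; have := H (fun i => if i == d then y else x i).
  rewrite big_ord_recr/= eqxx.
  under eq_bigr => i _ do rewrite (ltn_eqF (ltn_ord i)).
  under eq_eseriesr => k _.
    rewrite big_ord_recr/= eqxx.
    under eq_bigr => i _ do rewrite (ltn_eqF (ltn_ord i)).
    rewrite [(_ * itv_indic _ _ y)%R]mulrC mulrA; over.
  by rewrite [(_ * itv_indic _ _ y)%R]mulrC mulrA.
rewrite !big_ord_recr/= mulrA -/P.
under eq_eseriesr do rewrite big_ord_recr/= mulrA -/(Q _).
rewrite -integral_itv_indic// ?mulr_ge0//.
under eq_eseriesr => k _ do rewrite -integral_itv_indic ?mulr_ge0//.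
rewrite -integral_nneseries//.
- apply: ge0_le_integral => //.
  + by move=> y _; rewrite lee_fin !mulr_ge0.
  + by apply/measurable_EFinP/measurable_funM => //; exact: measurable_indic.
  + apply: ge0_emeasurable_sum => //.
      by move=> k y _ _; rewrite lee_fin !mulr_ge0.
    move=> k _.
    by apply/measurable_EFinP/measurable_funM => //; exact: measurable_indic.
- move=> k.
  by apply/measurable_EFinP/measurable_funM => //; exact: measurable_indic.
- by move=> k y _; rewrite lee_fin !mulr_ge0.
Qed.

Lemma lebesgue_outer_box_ge (n : nat) (a b : 'rV[R]_n.+1) :
  (forall i, (a 0 i <= b 0 i)%R) ->
  (box_volume a b)%:E <= lebesgue_outer (box a b).
Proof.
move=> ab; apply: le_ereal_inf_tmp => _ [A [B [AB cov ->]]].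
pose c (u : 'rV[R]_n.+1) (i : nat) := u 0%R (inord i).
have volE (u u' : 'rV[R]_n.+1) :
    (box_volume u u' = \prod_(i < n.+1) (c u' i - c u i))%R.
  by apply: eq_bigr => i _; rewrite /c inord_val.
rewrite volE -[X in X%:E <= _]mul1r.
under eq_eseriesr do rewrite volE -[X in X%:E]mul1r.
apply: (@prod_itv_indic_le n.+1 1 (c a) (c b) (fun=> 1%R) (c \o A) (c \o B)) => //=.
- by move=> i; exact: ab.
- by move=> k i; exact: AB.
move=> x; rewrite mul1r; under eq_eseriesr do rewrite mul1r.
have ge0 k : 0 <= (\prod_(i < n.+1) itv_indic (c (A k) i) (c (B k) i) (x i))%R%:E.
  by rewrite lee_fin; apply: prodr_ge0 => i _.
have [xab|xNab] := pselect (box a b (\row_i x i)); last first.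
  rewrite (_ : (\prod_(i < n.+1) _)%R = 0%R); first exact: nneseries_ge0.
  have /existsNP[i xi] := xNab.
  rewrite (bigD1 i)//= /itv_indic indicE memNset ?mul0r//=.
  by rewrite /c inord_val in_itv/=; move: xi; rewrite mxE.
have [k _ xk] := cov _ xab.
rewrite big1; last first.
  move=> i _; rewrite /itv_indic indicE mem_set//=.
  by rewrite /c inord_val in_itv/=; have := xab i; rewrite mxE.
(* The box [k] that contains the point contributes 1, so the partial sum through [k] suffices. *)
apply: le_trans (nneseries_lim_ge k.+1 _); last by move=> *.
rewrite big_nat_recr//= -[leLHS]add0e; apply: leeD; first exact: sume_ge0.
rewrite big1//; move=> i _; rewrite /itv_indic indicE mem_set//=.
by rewrite /c inord_val in_itv/=; have := xk i; rewrite mxE.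
Qed.

End box_volume_lower_bound.

(** * Measurability of Borel sets *)

Section lebesgue_measurable_sets.
Context (R : realType) (n : nat).
Local Notation V := 'rV[R]_n.+1.

Lemma box_volumeD1 (i : 'I_n.+1) (a b : V) : box_volume a b =
  (b 0 i - a 0 i) * \prod_(j < n.+1 | j != i) (b 0 j - a 0 j).
Proof. by rewrite /box_volume (bigD1 i). Qed.

(** The hyperplane cuts each box of a cover into two boxes whose volumes add up exactly. *)
Lemma caratheodory_half_space (i : 'I_n.+1) (c : R) :
  (@lebesgue_outer R n.+1).-caratheodory [set x | x 0 i <= c].
Proof.
apply: le_caratheodory_measurable => X; set H := [set x | _].
apply: le_ereal_inf_tmp => _ [a [b [ab cov ->]]].
(* The level [c] is clamped to the side of the box, so that both halves have ordered corners even
   when the hyperplane misses the box. *)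
pose mid k := Num.max (a k 0 i) (Num.min (b k 0 i) c).
pose a' k : V := \row_j if j == i then mid k else a k 0 j.
pose b' k : V := \row_j if j == i then mid k else b k 0 j.
have amid k : a k 0 i <= mid k by rewrite le_max lexx.
have midb k : mid k <= b k 0 i by rewrite ge_max ab ge_min lexx.
have ab' k j : a k 0 j <= b' k 0 j.
  by rewrite mxE; case: eqP => [->|_]; [exact: amid|exact: ab].
have a'b k j : a' k 0 j <= b k 0 j.
  by rewrite mxE; case: eqP => [->|_]; [exact: midb|exact: ab].
apply: (@le_trans _ _ (\sum_(0 <= k <oo) (box_volume (a k) (b' k))%:E +
                       \sum_(0 <= k <oo) (box_volume (a' k) (b k))%:E)%E).
  apply: leeD; apply: ereal_inf_lbound.
  - exists a, b'; split=> // x [Xx Hx]; have [k _ xk] := cov _ Xx.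
    exists k => // j; rewrite mxE; have := xk j => /andP[-> xb] /=.
    by case: eqP xb => // -> xb; rewrite le_max le_min xb Hx orbT.
  - exists a', b; split=> // x [Xx /negP Hx]; have [k _ xk] := cov _ Xx.
    exists k => // j; rewrite mxE; have := xk j => /andP[ax ->]; rewrite andbT.
    have cx : c <= x 0 i by apply: ltW; rewrite ltNge.
    by case: eqP ax => // -> ax; rewrite ge_max ax ge_min cx orbT.
rewrite -nneseriesD; [|by move=> k _ _; rewrite lee_fin box_volume_ge0..].
apply: lee_nneseries => [k _ _|k _].
  by rewrite -EFinD lee_fin addr_ge0// box_volume_ge0.
rewrite -EFinD lee_fin !(box_volumeD1 i) !mxE eqxx.
rewrite (eq_bigr (fun j => b k 0 j - a k 0 j)); last first.
  by move=> j /negbTE ji; rewrite mxE ji.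
rewrite [X in _ + _ * X](eq_bigr (fun j => b k 0 j - a k 0 j)); last first.
  by move=> j /negbTE ji; rewrite mxE ji.
by rewrite -mulrDl addrC subrKA.
Qed.

(** Rational corners make the family countable; half-open sides make each box a finite intersection
    of differences of half-spaces. *)
Definition rat_box (q : 'rV[rat]_n.+1 * 'rV[rat]_n.+1) : set V :=
  [set x | forall i, ratr (q.1 0 i) < x 0 i <= ratr (q.2 0 i)].

Lemma rat_box_nbhs (x : V) (e : R) : 0 < e ->
  exists q, rat_box q x /\ rat_box q `<=` ball x e.
Proof.
move=> e0.
have lo i : exists q : rat, x 0 i - e < ratr q < x 0 i.
  have /rat_in_itvoo[q] : x 0 i - e < x 0 i by rewrite ltrBlDr ltrDl.
  by rewrite in_itv/= => xq; exists q.
have hi i : exists q : rat, x 0 i < ratr q < x 0 i + e.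
  have /rat_in_itvoo[q] : x 0 i < x 0 i + e by rewrite ltrDl.
  by rewrite in_itv/= => xq; exists q.
have [p px] := choice lo; have [q qx] := choice hi.
exists (\row_i p i, \row_i q i); split=> [i|y yb] /=.
  rewrite !mxE; have /andP[_ ->] := px i.
  by have /andP[/ltW -> _] := qx i.
split=> // i j; rewrite ord1 /ball /= distrC ltr_distl.
have := yb j; rewrite !mxE => /andP[py yq].
have /andP[xp _] := px j; have /andP[_ xq] := qx j.
by rewrite (lt_trans xp py) (le_lt_trans yq xq).
Qed.

Local Notation leb := (caratheodory_type (@lebesgue_outer R n.+1)).

Lemma measurable_rat_box q : measurable (rat_box q : set leb).
Proof.
rewrite (_ : rat_box q = \bigcap_(i in [set: 'I_n.+1])
    ([set x : V | x 0 i <= ratr (q.2 0 i)] `\`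
     [set x : V | x 0 i <= ratr (q.1 0 i)])); last first.
  apply/seteqP; split=> x /= xq i; have := xq i.
  - by move=> /andP[xi xj] _; split=> //; apply/negP; rewrite -ltNge.
  - by move=> /(_ I)[xj /negP]; rewrite -ltNge => ->.
apply: fin_bigcap_measurable => // i _.
by apply: measurableD; exact: caratheodory_half_space.
Qed.

Lemma open_lebesgue_measurable (U : set V) : open U -> measurable (U : set leb).
Proof.
move=> oU; rewrite (_ : U = \bigcup_q (if `[< rat_box q `<=` U >]
    then rat_box q else set0)); last first.
  apply/seteqP; split=> [x Ux|x [q _]]; last by case: asboolP => // + ?; apply.
  have /nbhs_ballP[e e0 xeU] : nbhs x U by exact: open_nbhs_nbhs.
  have [q [qx qe]] := rat_box_nbhs x e0.
  by exists q => //; rewrite asboolT//; exact: subset_trans xeU.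
apply: countable_bigcupT_measurable => [|q]; first exact: countableP.
by case: asboolP => _ //; exact: measurable_rat_box.
Qed.

Lemma closed_lebesgue_measurable (F : set V) :
  closed F -> measurable (F : set leb).
Proof.
move=> cF; rewrite -[F]setCK; apply: measurableC.
by apply: open_lebesgue_measurable; exact: closed_openC.
Qed.

Lemma borel_lebesgue_measurable (A : set V) : borel A -> measurable (A : set leb).
Proof.
apply: smallest_sub; last by move=> U; exact: open_lebesgue_measurable.
by split=> [|B mB|F mF]; [exact: measurable0|rewrite setTD; exact: measurableC|
  exact: bigcupT_measurable].
Qed.

Lemma boxE (a b : V) : box a b = \bigcap_(i in [set: 'I_n.+1])
    ([set x : V | x 0 i <= b 0 i] `&` [set x : V | a 0 i <= x 0 i]).
Proof.
apply/seteqP; split=> x xab i; first by move=> _; have /andP[] := xab i.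
by have [] := xab i I => /= -> ->.
Qed.

Lemma closed_box (a b : V) : closed (box a b).
Proof.
rewrite boxE; apply: closed_bigI => i _; apply: closedI.
- apply: (@closed_comp _ _ (fun x : V => x 0 i) [set y | y <= b 0 i]) => //.
  by move=> x _; exact: coord_continuous.
- apply: (@closed_comp _ _ (fun x : V => x 0 i) [set y | a 0 i <= y]) => //.
  by move=> x _; exact: coord_continuous.
Qed.

Lemma lebesgue_outer_box (a b : V) : (forall i, a 0 i <= b 0 i) ->
  lebesgue_outer (box a b) = (box_volume a b)%:E.
Proof.
move=> ab; apply/eqP.
by rewrite eq_le lebesgue_outer_box_le//= lebesgue_outer_box_ge.
Qed.

Lemma coord_le_norm (x : V) i : `|x 0 i| <= `|x|.
Proof.
rewrite [leRHS]/Num.norm/= mx_normrE.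
exact: (le_bigmax _ (fun ij : 'I_1 * 'I_n.+1 => `|x ij.1 ij.2|) (0, i)).
Qed.

(** Tonelli's theorem, used in [large_xsections], asks for sigma-finiteness. *)
Lemma lebesgue_sigma_finite :
  sigma_finite [set: leb] (@lebesgue_outer R n.+1 : set leb -> \bar R).
Proof.
exists (fun k => box (const_mx (- k%:R)) (const_mx k%:R)).
  apply/seteqP; split=> // x _; exists (Num.bound `|x|) => // i.
  rewrite !mxE -ler_norml (le_trans _ (ltW (archi_boundP _)))//.
  exact: coord_le_norm.
move=> k; split; first exact/closed_lebesgue_measurable/closed_box.
by rewrite lebesgue_outer_box ?ltry// => i; rewrite !mxE ge0_cp.
Qed.

HB.instance Definition _ := isMeasure.Build _ leb R
  (@lebesgue_outer R n.+1 : set leb -> \bar R)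
  (@caratheodory_measure0 R _ (@lebesgue_outer R n.+1))
  (@caratheodory_measure_ge0 R _ (@lebesgue_outer R n.+1))
  (@caratheodory_measure_sigma_additive R _ (@lebesgue_outer R n.+1)).

HB.instance Definition _ := @Measure_isSigmaFinite.Build _ leb R
  (@lebesgue_outer R n.+1 : set leb -> \bar R) lebesgue_sigma_finite.

End lebesgue_measurable_sets.

(** The product is a polynomial in [s], hence continuous at 0. This pays both for inflating boxes to
    open ones and for rounding boxes to a grid. *)
Lemma prod_add_cvg (R : realType) (n : nat) (l : 'I_n -> R) (e : R) : 0 < e ->
  exists s0 : R, 0 < s0 /\ forall s, 0 <= s <= s0 ->
    \prod_(i < n) (l i + s) <= \prod_(i < n) l i + e.
Proof.
move=> e0; pose p : {poly R} := \prod_(i < n) ((l i)%:P + 'X).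
have pE s : p.[s] = \prod_(i < n) (l i + s).
  by rewrite horner_prod; apply: eq_bigr => i _; rewrite !hornerE.
have : {for 0, continuous (fun s => p.[s])} by exact: continuous_horner.
move=> /cvgrPdist_le/(_ e e0)/nbhs_ballP[d /= d0 dp].
exists (d / 2); split=> [|s /andP[s0 sd]]; first exact: divr_gt0.
have := dp s; rewrite /ball/= sub0r normrN ger0_norm//.
rewrite !pE (eq_bigr _ (fun i _ => addr0 (l i))) => /(_ _)/wrap[].
  by rewrite (le_lt_trans sd)// ltr_pdivrMr// ltr_pMr// ltr1n.
by rewrite distrC => /(le_trans (ler_norm _)); rewrite lerBlDl.
Qed.

Lemma outer_measure_bigsetU (R : realType) (T I : Type)
    (nu : {outer_measure set T -> \bar R}) (r : seq I) (P : pred I)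
    (F : I -> set T) :
  (nu (\big[setU/set0]_(i <- r | P i) F i) <= \sum_(i <- r | P i) nu (F i))%E.
Proof.
elim/big_rec2: _ => [|i y A _ Ay]; first by rewrite outer_measure0.
by apply: le_trans (outer_measureU2 _ _ _) _; exact: leeD2l.
Qed.

(** * Approximation by open and closed sets *)

Section regularity.
Context (R : realType) (n : nat).
Local Notation V := 'rV[R]_n.+1.
Local Notation leb := (caratheodory_type (@lebesgue_outer R n.+1)).

Lemma open_open_box (l u : V) : open [set x : V | forall i, l 0 i < x 0 i < u 0 i].
Proof.
rewrite openE => x xlu; rewrite /interior/=.
suff near_i : forall i : 'I_n.+1, \forall y \near x, l 0 i < (y : V) 0 i < u 0 i.
  have := @filter_forall _ _ (fun i (y : V) => l 0 i < y 0 i < u 0 i) _ _ near_i.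
  exact.
move=> i.
have xi : nbhs (x 0 i) `]l 0 i, u 0 i[%classic.
  by apply: open_nbhs_nbhs; split; [exact: interval_open|rewrite /= in_itv; exact: xlu].
have h := @coord_continuous R 1 n.+1 0 i x _ xi.
apply: (@filterS _ (nbhs x) _ _ _ _ h) => y /=.
by rewrite in_itv.
Qed.

Lemma lebesgue_outer_open_cover (S : set V) (e : R) : 0 < e ->
  exists U : set V, [/\ open U, S `<=` U &
    (lebesgue_outer U <= lebesgue_outer S + e%:E)%E].
Proof.
move=> e0; have e20 : 0 < e / 2 by rewrite divr_gt0.
have [Soo|] := eqVneq (lebesgue_outer S) +oo%E.
  by exists setT; split=> //; [exact: openT|rewrite Soo leey].
rewrite -ltey -ge0_fin_numE ?lebesgue_outer_ge0// => Sfin.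
have [_ [a [b [ab Sab ->]]] abS] := lb_ereal_inf_adherent e20 Sfin.
(* Half of [e] went to the near-optimal cover; the [ek k], of total [e / 2], pay for inflating its
   boxes. *)
pose ek (k : nat) := e / 2 / (2 ^ k.+1)%:R.
have ek0 k : 0 < ek k by rewrite divr_gt0// ltr0n expn_gt0.
have [s sP] := choice (fun k => prod_add_cvg (fun i => b k 0 i - a k 0 i) (ek0 k)).
have s0 k : 0 < s k by have [] := sP k.
pose l k : V := \row_i (a k 0 i - s k / 2).
pose u k : V := \row_i (b k 0 i + s k / 2).
have lu k i : l k 0 i <= u k 0 i.
  by rewrite !mxE lerBlDr (le_trans (ab k i))// -addrA lerDl addr_ge0 ?divr_ge0// ltW.
exists (\bigcup_k [set x : V | forall i, l k 0 i < x 0 i < u k 0 i]); split.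
- by apply: bigcup_open => k _; exact: open_open_box.
- move=> x /Sab[k _ xk]; exists k => // i; rewrite !mxE.
  have /andP[ax xb] := xk i.
  by apply/andP; split; [rewrite ltrBlDr (le_lt_trans ax)//|
    rewrite (le_lt_trans xb)//]; rewrite ltrDl divr_gt0.
apply: le_trans (outer_measure_sigma_subadditive (@lebesgue_outer R n.+1) _) _.
apply: (@le_trans _ _ (\sum_(0 <= k <oo)
    ((box_volume (a k) (b k))%:E + (e / 2 / (2 ^ k.+1)%:R)%:E))%E).
  apply: lee_nneseries => [k _ _|k _]; first exact: lebesgue_outer_ge0.
  apply: (@le_trans _ _ (lebesgue_outer (box (l k) (u k)))).
    by apply: le_lebesgue_outer => x xk i; have /andP[/ltW -> /ltW ->] := xk i.
  apply: le_trans (lebesgue_outer_box_le (lu k)) _.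
  rewrite -EFinD lee_fin; have [_ /(_ (s k))] := sP k.
  rewrite lexx ltW// => /(_ isT); apply: le_trans.
  rewrite le_eqVlt; apply/orP; left; apply/eqP; apply: eq_bigr => i _.
  by rewrite !mxE; lra.
apply: le_trans (epsilon_trick _ _ (ltW e20)) _.
  by move=> k; rewrite lee_fin box_volume_ge0.
rewrite [in leRHS](splitr e) EFinD addeA leeD2r// ltW//.
Qed.

Lemma lebesgue_outer_regular (X : set leb) (e : R) : measurable X ->
  (lebesgue_outer X < +oo)%E -> 0 < e ->
  exists U : set V, [/\ open U, X `<=` U & (lebesgue_outer (U `\` X) <= e%:E)%E].
Proof.
move=> mX Xoo e0; have [U [oU XU Ue]] := lebesgue_outer_open_cover X e0.
exists U; split=> //; have Xfin : lebesgue_outer X \is a fin_num.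
  by rewrite ge0_fin_numE// lebesgue_outer_ge0.
have UE : lebesgue_outer U = (lebesgue_outer X + lebesgue_outer (U `\` X))%E.
  by have := mX U; rewrite setIC (setIidl XU) -setDE.
by move: Ue; rewrite UE leeD2lE.
Qed.

Lemma norm_le_coord (x : V) (r : R) : 0 <= r ->
  (forall i, `|x 0 i| <= r) -> `|x| <= r.
Proof.
move=> r0 xr; rewrite [leLHS]/Num.norm/= mx_normrE.
by apply: bigmax_le => // -[i j] _; rewrite ord1 xr.
Qed.

Lemma bounded_box (a b : V) : bounded_set (box a b).
Proof.
exists (`|a| + `|b|); split; first by rewrite num_real.
move=> M abM x xab /=; rewrite (le_trans _ (ltW abM))//.
apply: norm_le_coord => [|i]; first exact: addr_ge0.
have /andP[ax xb] := xab i.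
have /lerNnormlW aN := coord_le_norm a i.
have bN := le_trans (ler_norm _) (coord_le_norm b i).
have := normr_ge0 a; have := normr_ge0 b.
by rewrite ler_norml => ? ?; apply/andP; split; lra.
Qed.

(** Outer regularity for the complement of [A] in the box: remove from the box an open set that
    barely exceeds this complement. *)
Lemma lebesgue_inner_regular (A : set leb) (a b : V) (e : R) : measurable A ->
  (forall i, a 0 i <= b 0 i) -> 0 < e ->
  exists G : set V, [/\ closed G, G `<=` A `&` box a b &
    (lebesgue_outer ((A `&` box a b) `\` G) <= e%:E)%E].
Proof.
move=> mA ab e0.
have mD : measurable (box a b : set leb).
  exact/closed_lebesgue_measurable/closed_box.
have [|U [oU XU Ue]] := lebesgue_outer_regular (measurableD mD mA) _ e0.
  apply: le_lt_trans (le_lebesgue_outer (@subDsetl _ _ _)) _.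
  by rewrite lebesgue_outer_box// ltry.
exists (box a b `\` U); split.
- by apply: closedI; [exact: closed_box|exact: open_closedC].
- move=> x [xD xU]; split=> //; apply: contrapT => xA.
  by apply: xU; apply: XU.
- apply: le_trans Ue; apply: le_lebesgue_outer => x [[xA xD] xG].
  split=> [|[_]//]; apply: contrapT => xU.
  by apply: xG; split.
Qed.

End regularity.

(** * Domination of outer measures by Lebesgue measure *)

Section cube_domination.
Context (R : realType) (n : nat).
Local Notation V := 'rV[R]_n.+1.
Variables (nu : {outer_measure set V -> \bar R}) (kappa s0 : R).
Hypotheses (kappa0 : 0 < kappa) (s00 : 0 < s0).
Hypothesis nu_cube : forall (a : V) (s : R), 0 < s <= s0 ->
  (nu (box a (a + const_mx s)) <= (kappa * s ^+ n.+1)%:E)%E.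

(** Count the cells of the grid of mesh [s] anchored at [a]: direction [i] takes at most
    [(b 0 i - a 0 i) / s + 1] of them, whence the extra [s] in each factor. *)
Let nu_box_add (a b : V) (s : R) : (forall i, a 0 i <= b 0 i) -> 0 < s <= s0 ->
  (nu (box a b) <= (kappa * \prod_(i < n.+1) (b 0 i - a 0 i + s))%:E)%E.
Proof.
move=> ab ss0; have /andP[s_gt0 _] := ss0.
pose j (x : R) i := Num.truncn ((x - a 0 i) / s).
pose p i := (j (b 0 i) i).+1.
pose N := \max_(i < n.+1) p i.
(* All directions share the index type ['I_N]; [Q] cuts it down to the count [p i], so that the sum
   over [family Q] factors over the directions. *)
pose Q (i : 'I_n.+1) := [pred k : 'I_N | (k < p i)%N].
pose corner (f : {ffun 'I_n.+1 -> 'I_N}) : V := \row_i (a 0 i + s * (f i)%:R).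
have cov : box a b `<=` \big[setU/set0]_(f in family Q)
    box (corner f) (corner f + const_mx s).
  move=> x xab; have jp i : (j (x 0%R i) i < p i)%N.
    rewrite ltnS le_truncn// ler_pM2r ?invr_gt0// lerD2r.
    by have /andP[] := xab i.
  have jN i : (j (x 0%R i) i < N)%N := leq_trans (jp i) (leq_bigmax i).
  rewrite -bigcup_seq_cond; exists [ffun i => Ordinal (jN i)].
    by rewrite /= mem_index_enum; apply/familyP => i; rewrite ffunE inE; exact: jp.
  move=> i; rewrite !mxE ffunE /=; have /andP[ax _] := xab i.
  have /truncn_itv : 0 <= (x 0 i - a 0 i) / s by rewrite divr_ge0 ?subr_ge0// ltW.
  rewrite -/(j (x 0 i) i) ler_pdivlMr// ltr_pdivrMr// => /andP[jx xj].
  rewrite -lerBrDl mulrC jx/= -addrA -lerBlDl (le_trans (ltW xj))//.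
  by rewrite -natr1 mulrDl mul1r mulrC.
apply: le_trans (le_outer_measure nu _ _ cov) _.
apply: le_trans (outer_measure_bigsetU _ _ _ _) _.
apply: (@le_trans _ _ (\sum_(f in family Q) (kappa * \prod_(i < n.+1) s)%:E)%E).
  apply: lee_sum => f _; apply: le_trans (nu_cube _ ss0) _.
  by rewrite prodr_const card_ord.
rewrite sumEFin lee_fin -mulr_sumr ler_pM2l//.
rewrite -(bigA_distr_big_dep Q (fun _ _ => s)).
apply: ler_prod => i _; apply/andP; split; first by apply: sumr_ge0 => *; exact: ltW.
rewrite -(big_ord_widen_cond _ xpredT (fun=> s))//; last exact: (leq_bigmax i).
rewrite sumr_const card_ord -mulr_natl /p -natr1 mulrDl mul1r lerD2r.
by rewrite -ler_pdivlMr// truncn_le divr_ge0 ?subr_ge0// ltW.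
Qed.

Let nu_box (a b : V) : (forall i, a 0 i <= b 0 i) ->
  (nu (box a b) <= (kappa * box_volume a b)%:E)%E.
Proof.
move=> ab; apply/lee_addgt0Pr => e e0.
have [s [s_gt0 sP]] := prod_add_cvg (fun i => b 0 i - a 0 i) (divr_gt0 e0 kappa0).
pose t := Num.min s s0.
have ts : 0 < t <= s0 by rewrite lt_min s_gt0 s00 ge_min lexx orbT.
apply: le_trans (nu_box_add ab ts) _; rewrite -EFinD lee_fin.
rewrite (_ : e = kappa * (e / kappa)); last by rewrite mulrC divfK// gt_eqF.
rewrite -mulrDr ler_pM2l//; apply: sP.
by have /andP[/ltW -> _] := ts; rewrite ge_min lexx.
Qed.

(** Subadditivity reduces the claim to boxes, and fine grids reduce boxes to small cubes without
    loss in [kappa], as the sharp bound [hausdorff_raw_le_lebesgue] requires. Asking only about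
    sides up to [s0] admits [hausdorff_delta], which is bounded by a power of the diameter only at
    diameters up to [delta]. *)
Lemma outer_measure_le_lebesgue (S : set V) :
  (nu S <= kappa%:E * lebesgue_outer S)%E.
Proof.
rewrite -lee_pdivrMl//; apply: le_ereal_inf_tmp => _ [a [b [ab cov ->]]].
rewrite lee_pdivrMl// -nneseriesZl; last first.
  by move=> k _; rewrite lee_fin box_volume_ge0.
apply: le_trans (le_outer_measure nu _ _ cov) _.
apply: le_trans (outer_measure_sigma_subadditive nu _) _.
apply: lee_nneseries => [k _ _|k _]; first exact: outer_measure_ge0.
by rewrite -EFinM; exact: nu_box.
Qed.

End cube_domination.

(** * Hausdorff measure *)

Section euclidean_norm.
Context (R : realType) (n : nat).
Implicit Types x y z : 'rV[R]_n.

Lemma dotvC x y : dotv x y = dotv y x.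
Proof. by apply: eq_bigr => i _; rewrite mulrC. Qed.

Lemma dotvDl x y z : dotv (x + y) z = dotv x z + dotv y z.
Proof. by rewrite -big_split; apply: eq_bigr => i _; rewrite mxE mulrDl. Qed.

Lemma dotvZl a x y : dotv (a *: x) y = a * dotv x y.
Proof. by rewrite mulr_sumr; apply: eq_bigr => i _; rewrite mxE mulrA. Qed.

Lemma dotvNl x y : dotv (- x) y = - dotv x y.
Proof. by rewrite -scaleN1r dotvZl mulN1r. Qed.

Lemma dotvBl x y z : dotv (x - y) z = dotv x z - dotv y z.
Proof. by rewrite dotvDl dotvNl. Qed.

Lemma dotvDr x y z : dotv x (y + z) = dotv x y + dotv x z.
Proof. by rewrite !(dotvC x) dotvDl. Qed.

Lemma dotvZr a x y : dotv x (a *: y) = a * dotv x y.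
Proof. by rewrite !(dotvC x) dotvZl. Qed.

Lemma dotv0l x : dotv 0 x = 0.
Proof. by rewrite -(scale0r x) dotvZl mul0r. Qed.

Lemma dotv_suml (I : Type) (r : seq I) (P : pred I) (F : I -> 'rV[R]_n) x :
  dotv (\sum_(i <- r | P i) F i) x = \sum_(i <- r | P i) dotv (F i) x.
Proof. by elim/big_rec2: _ => [|i a b _ <-]; rewrite ?dotv0l ?dotvDl. Qed.

Lemma dotvv_ge0 x : 0 <= dotv x x.
Proof. by apply: sumr_ge0 => i _; rewrite -expr2 sqr_ge0. Qed.

Lemma dotvv_eq0 x : dotv x x = 0 -> x = 0.
Proof.
move=> /eqP; rewrite psumr_eq0 => [/allP x0|i _]; last by rewrite -expr2 sqr_ge0.
by apply/rowP => i; apply/eqP; have := x0 i (mem_index_enum i);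
  rewrite mulf_eq0 orbb mxE.
Qed.

Lemma enorm_ge0 x : 0 <= enorm x.
Proof. exact: sqrtr_ge0. Qed.

Lemma sqr_enorm x : enorm x ^+ 2 = dotv x x.
Proof. by rewrite sqr_sqrtr// dotvv_ge0. Qed.

Lemma enorm0 : enorm (0 : 'rV[R]_n) = 0.
Proof. by rewrite /enorm dotv0l sqrtr0. Qed.

Lemma enorm_eq0 x : enorm x = 0 -> x = 0.
Proof. by move=> x0; apply: dotvv_eq0; rewrite -sqr_enorm x0 expr0n. Qed.

Lemma enormZ a x : enorm (a *: x) = `|a| * enorm x.
Proof.
by rewrite /enorm dotvZl dotvZr mulrA -expr2 sqrtrM ?sqr_ge0// sqrtr_sqr.
Qed.

Lemma enormN x : enorm (- x) = enorm x.
Proof. by rewrite -scaleN1r enormZ normrN1 mul1r. Qed.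

Lemma enorm_sub x y : enorm (x - y) = enorm (y - x).
Proof. by rewrite -enormN opprB. Qed.

Lemma dotv_le_enorm x y : dotv x y <= enorm x * enorm y.
Proof.
have [/enorm_eq0->|x0] := eqVneq (enorm x) 0; first by rewrite dotv0l enorm0 mul0r.
have [/enorm_eq0->|y0] := eqVneq (enorm y) 0.
  by rewrite dotvC dotv0l enorm0 mulr0.
have {}x0 : 0 < enorm x by rewrite lt_neqAle eq_sym x0 enorm_ge0.
have {}y0 : 0 < enorm y by rewrite lt_neqAle eq_sym y0 enorm_ge0.
have := dotvv_ge0 (enorm y *: x - enorm x *: y).
rewrite dotvBl !(dotvC _ (_ - _)) !dotvBl !dotvZl !dotvZr.
rewrite -!sqr_enorm (dotvC y x).
set a := enorm x in x0 *; set b := enorm y in y0 *; set d := dotv x y.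
have -> : b * (b * a ^+ 2) - a * (b * d) - (b * (a * d) - a * (a * b ^+ 2)) =
  (2 * a * b) * (a * b - d) by ring.
by rewrite pmulr_rge0 ?subr_ge0// mulr_gt0// mulr_gt0.
Qed.

Lemma enormD x y : enorm (x + y) <= enorm x + enorm y.
Proof.
rewrite -(@ler_pXn2r _ 2)// ?nnegrE ?addr_ge0 ?enorm_ge0//.
rewrite sqrrD !sqr_enorm dotvDl !dotvDr (dotvC y x).
by have := dotv_le_enorm x y; lra.
Qed.

Lemma enormB x y : enorm x - enorm y <= enorm (x - y).
Proof. by rewrite lerBlDr; have := enormD (x - y) y; rewrite subrK. Qed.

Lemma coord_le_enorm x i : `|x 0 i| <= enorm x.
Proof.
rewrite -sqrtr_sqr ler_wsqrtr// /dotv (bigD1 i)//= -expr2 lerDl.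
by apply: sumr_ge0 => j _; rewrite -expr2 sqr_ge0.
Qed.

Lemma enorm_le_coord x (r : R) : 0 <= r ->
  (forall i, `|x 0 i| <= r) -> enorm x <= n%:R * r.
Proof.
move=> r0 xr; rewrite -(ger0_norm (mulr_ge0 (ler0n R n) r0)) -sqrtr_sqr.
apply: ler_wsqrtr; apply: (@le_trans _ _ (\sum_(i < n) r ^+ 2)).
  apply: ler_sum => i _; rewrite -expr2 -real_normK ?num_real//.
  by rewrite ler_pXn2r// nnegrE.
rewrite sumr_const card_ord exprMn -[leLHS]mulr_natl ler_wpM2r ?sqr_ge0//.
by rewrite -natrX ler_nat; case: (n) => // k; rewrite leq_pmulr.
Qed.

End euclidean_norm.


Section diameter.
Context (R : realType) (n : nat).
Implicit Types C D : set 'rV[R]_n.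
Local Open Scope ereal_scope.

Lemma diam_ge0 C : 0 <= diam C.
Proof. by apply: ereal_sup_ubound; left. Qed.

Lemma diam_le C (d : R) : (0 <= d)%R ->
  (forall x y, C x -> C y -> (enorm (x - y) <= d)%R) -> diam C <= d%:E.
Proof.
move=> d0 Cd; apply: ge_ereal_sup => _ [->|[x [y [Cx Cy ->]]]].
  by rewrite lee_fin.
by rewrite lee_fin Cd.
Qed.

Lemma enorm_le_diam C x y : C x -> C y -> (enorm (x - y))%:E <= diam C.
Proof. by move=> Cx Cy; apply: ereal_sup_ubound; right; exists x, y. Qed.

Lemma diam_set0 : diam (set0 : set 'rV[R]_n) = 0.
Proof.
apply/eqP; rewrite eq_le diam_ge0 andbT -[leRHS]/(0%R%:E).
by apply: diam_le.
Qed.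

Lemma diam_fin C (d : R) : diam C <= d%:E -> diam C = (fine (diam C))%:E.
Proof.
move=> Cd; rewrite fineK// ge0_fin_numE ?diam_ge0//.
by rewrite (le_lt_trans Cd)// ltry.
Qed.

Lemma fine_diam_ge0 C : (0 <= fine (diam C))%R.
Proof. exact/fine_ge0/diam_ge0. Qed.

Lemma enorm_le_fine_diam C (d : R) x y : diam C <= d%:E -> C x -> C y ->
  (enorm (x - y) <= fine (diam C))%R.
Proof.
by move=> Cd Cx Cy; rewrite -lee_fin -(diam_fin Cd) enorm_le_diam.
Qed.

End diameter.

Lemma lebesgue_outer_le_diam (R : realType) (n : nat) (C : set 'rV[R]_n.+1)
    (d : R) : 0 <= d -> (forall x y, C x -> C y -> enorm (x - y) <= d) ->
  (lebesgue_outer C <= ((2 * d) ^+ n.+1)%:E)%E.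
Proof.
move=> d0 Cd; have [->|/set0P[x Cx]] := eqVneq C set0.
  by rewrite lebesgue_outer_set0 lee_fin exprn_ge0// mulr_ge0.
have ab i : (x - const_mx d) 0 i <= (x + const_mx d) 0 i by rewrite !mxE; lra.
apply: (@le_trans _ _ (lebesgue_outer (box (x - const_mx d) (x + const_mx d)))).
  apply: le_lebesgue_outer => y Cy i.
  have := le_trans (coord_le_enorm (y - x) i) (Cd _ _ Cy Cx).
  by rewrite !mxE ler_norml => /andP[? ?]; apply/andP; split; lra.
apply: le_trans (lebesgue_outer_box_le ab) _; rewrite lee_fin /box_volume.
rewrite (eq_bigr (fun=> 2 * d)) ?prodr_const ?card_ord// => i _.
by rewrite !mxE; ring.
Qed.

(** For fixed [N] and [f] the left side is itself an outer measure in [S], so it suffices to bound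
    it on cubes. The part of [N] sent into a cube of side [s] has diameter at most
    [Lam * n.+1%:R * s]. *)
Lemma lebesgue_outer_expansion (R : realType) (n : nat)
    (N : set 'rV[R]_n.+1) (f : 'rV[R]_n.+1 -> 'rV[R]_n.+1) (Lam : R) :
  0 < Lam ->
  (forall x y, N x -> N y -> enorm (x - y) <= Lam * enorm (f x - f y)) ->
  forall S, (lebesgue_outer (N `&` f @^-1` S) <=
    ((2 * (Lam * n.+1%:R)) ^+ n.+1)%:E * lebesgue_outer S)%E.
Proof.
move=> Lam0 Nf S; pose nu (A : set 'rV[R]_n.+1) := lebesgue_outer (N `&` f @^-1` A).
have nu0 : nu set0 = 0%E by rewrite /nu preimage_set0 setI0 lebesgue_outer_set0.
have nu_ge0 A : (0 <= nu A)%E by exact: lebesgue_outer_ge0.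
have le_nu : {homo nu : A B / A `<=` B >-> (A <= B)%E}.
  by move=> A B AB; apply: le_lebesgue_outer => x [Nx Ax]; split=> //; exact: AB.
have nu_sigma : sigma_subadditive nu.
  move=> F; rewrite /nu preimage_bigcup setI_bigcupr.
  exact: lebesgue_outer_sigma_subadditive.
pose om : {outer_measure set 'rV[R]_n.+1 -> \bar R} := HB.pack_for
  (outer_measure R 'rV[R]_n.+1) nu (isOuterMeasure.Build R _ nu nu0 nu_ge0 le_nu nu_sigma).
have L0 : 0 < 2 * (Lam * n.+1%:R) by rewrite !mulr_gt0// ltr0n.
apply: (@outer_measure_le_lebesgue R n om _ 1) => //; first by rewrite exprn_gt0.
move=> a s /andP[s0 _]; rewrite -exprMn -!mulrA.
apply: lebesgue_outer_le_diam => [|x y [Nx fx] [Ny fy]].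
  by rewrite !mulr_ge0// ltW.
apply: le_trans (Nf _ _ Nx Ny) _; rewrite ler_pM2l//.
apply: enorm_le_coord => [|i]; first exact: ltW.
have := fx i; have := fy i; rewrite !mxE ler_norml.
by move=> /andP[? ?] /andP[? ?]; apply/andP; split; lra.
Qed.

(** * Hausdorff outer measure and expanding maps *)

Section hausdorff_outer_measure.
Context (R : realType) (m n : nat).
Local Notation V := 'rV[R]_n.
Local Open Scope ereal_scope.

Section fixed_delta.
Variable delta : R.
Hypothesis delta0 : (0 <= delta)%R.

Lemma hausdorff_deltaE (S : set V) : hausdorff_delta m.+1 delta S =
  cover_inf (fun C : set V => diam C <= delta%:E) id (fun C => diam C ^+ m.+1) S.
Proof. by []. Qed.

Lemma hausdorff_delta_ge0 (S : set V) : 0 <= hausdorff_delta m.+1 delta S.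
Proof. by rewrite hausdorff_deltaE; apply: cover_inf_ge0 => C _; apply: expe_ge0; exact: diam_ge0. Qed.

Lemma le_hausdorff_delta :
  {homo (@hausdorff_delta R m.+1 n delta) : A B / A `<=` B >-> A <= B}.
Proof. by move=> A B AB; rewrite !hausdorff_deltaE; exact: le_cover_inf. Qed.

Lemma hausdorff_delta_sigma_subadditive :
  sigma_subadditive (@hausdorff_delta R m.+1 n delta).
Proof.
move=> F; rewrite hausdorff_deltaE.
under eq_eseriesr do rewrite hausdorff_deltaE.
by apply: cover_inf_sigma_subadditive => C _; apply: expe_ge0; exact: diam_ge0.
Qed.

Lemma hausdorff_delta_le_diam (C : set V) : diam C <= delta%:E ->
  hausdorff_delta m.+1 delta C <= diam C ^+ m.+1.
Proof.
move=> Cd; apply: ereal_inf_lbound.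
(* Padding with the empty set is free, since its diameter 0 is raised to the positive power
   [m.+1]. *)
exists (fun k => if (k == 0)%N then C else set0); split=> [[|k]//|x Cx|].
- by rewrite diam_set0 lee_fin.
- by exists 0%N.
rewrite nneseries_recl//; last by move=> k _; apply: expe_ge0; exact: diam_ge0.
rewrite eseries_cond eseries0 ?adde0// => -[|k] _ // _.
by rewrite diam_set0 expeS mul0e.
Qed.

Lemma hausdorff_delta_set0 : hausdorff_delta m.+1 delta (set0 : set V) = 0.
Proof.
apply/eqP; rewrite eq_le hausdorff_delta_ge0 andbT.
apply: le_trans (hausdorff_delta_le_diam _) _; rewrite diam_set0 ?lee_fin//.
by rewrite expeS mul0e.
Qed.

End fixed_delta.

Lemma hausdorff_delta_le_raw (delta : R) (S : set V) : (0 < delta)%R ->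
  hausdorff_delta m.+1 delta S <= hausdorff_raw m.+1 S.
Proof. by move=> d0; apply: ereal_sup_ubound; exists delta. Qed.

Lemma hausdorff_raw_le (S : set V) (x : \bar R) :
  (forall delta : R, (0 < delta)%R -> hausdorff_delta m.+1 delta S <= x) ->
  hausdorff_raw m.+1 S <= x.
Proof. by move=> Sx; apply: ge_ereal_sup => _ [d d0 <-]; exact: Sx. Qed.

Lemma hausdorff_raw_ge0 (S : set V) : 0 <= hausdorff_raw m.+1 S.
Proof.
exact: le_trans (hausdorff_delta_ge0 1 S) (hausdorff_delta_le_raw S ltr01).
Qed.

Lemma hausdorff_raw_set0 : hausdorff_raw m.+1 (set0 : set V) = 0.
Proof.
apply/eqP; rewrite eq_le hausdorff_raw_ge0 andbT; apply: hausdorff_raw_le => d d0.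
by rewrite hausdorff_delta_set0// ltW.
Qed.

Lemma le_hausdorff_raw :
  {homo (@hausdorff_raw R m.+1 n) : A B / A `<=` B >-> A <= B}.
Proof.
move=> A B AB; apply: hausdorff_raw_le => d d0.
exact: le_trans (le_hausdorff_delta d AB) (hausdorff_delta_le_raw B d0).
Qed.

Lemma hausdorff_raw_sigma_subadditive : sigma_subadditive (@hausdorff_raw R m.+1 n).
Proof.
move=> F; apply: hausdorff_raw_le => d d0.
apply: le_trans (hausdorff_delta_sigma_subadditive d F) _.
apply: lee_nneseries => k _; first by move=> _; exact: hausdorff_delta_ge0.
exact: hausdorff_delta_le_raw.
Qed.

HB.instance Definition _ := isOuterMeasure.Build R V (@hausdorff_raw R m.+1 n)
  hausdorff_raw_set0 hausdorff_raw_ge0 le_hausdorff_raw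
  hausdorff_raw_sigma_subadditive.

End hausdorff_outer_measure.

(** Covers of the image pull back to covers of [S] whose diameters grow at most by the factor [Lam];
    hence the image is covered at scale [d / Lam]. *)
Lemma hausdorff_raw_expansion (R : realType) (m p q : nat)
    (f : 'rV[R]_p -> 'rV[R]_q) (S : set 'rV[R]_p) (Lam : R) : 0 < Lam ->
  (forall x y, S x -> S y -> enorm (x - y) <= Lam * enorm (f x - f y)) ->
  (hausdorff_raw m.+1 S <= (Lam ^+ m.+1)%:E * hausdorff_raw m.+1 (f @` S))%E.
Proof.
move=> Lam0 Sf; apply: hausdorff_raw_le => d d0.
have dL : 0 < d / Lam by rewrite divr_gt0.
have LM : 0 < Lam ^+ m.+1 by rewrite exprn_gt0.
rewrite -lee_pdivrMl//; apply: le_trans (hausdorff_delta_le_raw m (f @` S) dL).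
apply: le_ereal_inf_tmp => _ [C [Cd cov ->]]; rewrite lee_pdivrMl//.
pose D k := S `&` f @^-1` C k.
have diamD k : (diam (D k) <= (Lam * fine (diam (C k)))%:E)%E.
  apply: diam_le; first by rewrite mulr_ge0 ?fine_diam_ge0// ltW.
  move=> x y [Sx fx] [Sy fy]; apply: le_trans (Sf _ _ Sx Sy) _.
  by rewrite ler_pM2l// (enorm_le_fine_diam (Cd k)).
rewrite -nneseriesZl; last by move=> k _; apply: expe_ge0; exact: diam_ge0.
apply: (@le_trans _ _ (\sum_(0 <= k <oo) diam (D k) ^+ m.+1)%E).
  apply: ereal_inf_lbound; exists D; split=> // [k|x Sx].
    apply: le_trans (diamD k) _; rewrite lee_fin mulrC -ler_pdivlMr//.
    by rewrite -lee_fin -(diam_fin (Cd k)).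
  by have [k _ Cfx] := cov (f x) (imageP f Sx); exists k.
apply: lee_nneseries => [k _ _|k _]; first by apply: expe_ge0; exact: diam_ge0.
have := diamD k; rewrite (diam_fin (diamD k)) (diam_fin (Cd k)) lee_fin => DC.
by rewrite -!EFin_expe -EFinM lee_fin -exprMn ler_pXn2r// nnegrE ?mulr_ge0
  ?fine_diam_ge0// ltW.
Qed.


(** * Comparison of Hausdorff and Lebesgue measure *)

Section hausdorff_vs_lebesgue.
Context (R : realType) (m : nat).
Local Notation V := 'rV[R]_m.+1.
Local Notation leb := (caratheodory_type (@lebesgue_outer R m.+1)).
Local Notation unit_cube := (box (const_mx 0 : V) (const_mx 1)).

Lemma enorm_cube (a : V) (s : R) x y :
  box a (a + const_mx s) x -> box a (a + const_mx s) y ->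
  enorm (x - y) <= m.+1%:R * s.
Proof.
move=> ax ay; have s0 : 0 <= s.
  by have := ax 0; rewrite !mxE => /andP[? ?]; lra.
apply: enorm_le_coord => // i; have := ax i; have := ay i.
by rewrite !mxE ler_norml => /andP[? ?] /andP[? ?]; apply/andP; split; lra.
Qed.

Lemma box_volume_cube (a : V) (s : R) : box_volume a (a + const_mx s) = s ^+ m.+1.
Proof.
rewrite /box_volume (eq_bigr (fun=> s)) ?prodr_const ?card_ord// => i _.
by rewrite !mxE addrAC subrr add0r.
Qed.

Lemma unit_cubeE : unit_cube = box (const_mx 0) (const_mx 0 + const_mx 1 : V).
Proof. by congr box; apply/rowP => i; rewrite !mxE add0r. Qed.

Lemma lebesgue_unit_cube : lebesgue_outer unit_cube = 1%E.
Proof.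
rewrite unit_cubeE lebesgue_outer_box ?box_volume_cube ?expr1n// => i.
by rewrite !mxE add0r.
Qed.

Lemma hausdorff_raw_unit_cube_lty : (hausdorff_raw m.+1 unit_cube < +oo)%E.
Proof.
apply: (@le_lt_trans _ _ (m.+1%:R ^+ m.+1)%:E); last exact: ltry.
apply: hausdorff_raw_le => d d0.
pose om : {outer_measure set V -> \bar R} := HB.pack_for
  (outer_measure R V) (@hausdorff_delta R m.+1 m.+1 d)
  (isOuterMeasure.Build R V (@hausdorff_delta R m.+1 m.+1 d)
    (hausdorff_delta_set0 _ _ (ltW d0)) (hausdorff_delta_ge0 _ d)
    (le_hausdorff_delta _ d) (hausdorff_delta_sigma_subadditive _ d)).
rewrite -[leRHS]mule1 -lebesgue_unit_cube.
have m0 : 0 < m.+1%:R :> R by rewrite ltr0n.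
(* Cubes up to this side have diameter at most [d], so each is its own cover at scale [d]; the
   resulting bound is uniform in [d]. *)
apply: (@outer_measure_le_lebesgue R m om _ (d / m.+1%:R)).
- by rewrite exprn_gt0.
- by rewrite divr_gt0.
move=> a s /andP[s0 sd].
have dcube : (diam (box a (a + const_mx s)) <= (m.+1%:R * s)%:E)%E.
  by apply: diam_le => [|x y]; [rewrite mulr_ge0// ltW|exact: enorm_cube].
apply: (@le_trans _ _ (diam (box a (a + const_mx s)) ^+ m.+1)%E).
  apply: hausdorff_delta_le_diam; first exact: ltW.
  by apply: le_trans dcube _; rewrite lee_fin mulrC -ler_pdivlMr.
rewrite (diam_fin dcube) -EFin_expe lee_fin -exprMn ler_pXn2r ?nnegrE ?fine_diam_ge0//.
  by rewrite -lee_fin -(diam_fin dcube).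
by rewrite mulr_ge0// ltW.
Qed.

(** Twice the diameter, to the power [m.+1], bounds the Lebesgue measure of each piece of a cover,
    so covering sums stay away from 0. *)
Lemma hausdorff_raw_unit_cube_gt0 : (0 < hausdorff_raw m.+1 unit_cube)%E.
Proof.
apply: lt_le_trans (hausdorff_delta_le_raw m unit_cube ltr01).
apply: (@lt_le_trans _ _ ((2 ^+ m.+1)^-1)%:E).
  by rewrite lte_fin invr_gt0 exprn_gt0.
apply: le_ereal_inf_tmp => _ [C [Cd cov ->]].
rewrite -[leLHS]mule1 lee_pdivrMl ?exprn_gt0// -lebesgue_unit_cube.
rewrite -nneseriesZl; last by move=> k _; apply: expe_ge0; exact: diam_ge0.
apply: le_trans (le_lebesgue_outer cov) _.
apply: le_trans (lebesgue_outer_sigma_subadditive _) _.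
apply: lee_nneseries => [k _ _|k _]; first exact: lebesgue_outer_ge0.
rewrite (diam_fin (Cd k)) -EFin_expe -EFinM -exprMn.
apply: lebesgue_outer_le_diam => [|x y]; first exact: fine_diam_ge0.
exact: enorm_le_fine_diam (Cd k).
Qed.

(** The reciprocal of [hausdorff_const R m.+1]; the two cancel in [ratio_ge]. *)
Definition cube_const : R := fine (hausdorff_raw m.+1 unit_cube).

Lemma cube_constE : hausdorff_raw m.+1 unit_cube = cube_const%:E.
Proof.
rewrite /cube_const fineK// ge0_fin_numE ?hausdorff_raw_ge0//.
exact: hausdorff_raw_unit_cube_lty.
Qed.

Lemma cube_const_gt0 : 0 < cube_const.
Proof. by rewrite -lte_fin -cube_constE hausdorff_raw_unit_cube_gt0. Qed.

Lemma hausdorff_raw_cube_le (a : V) (s : R) : 0 < s ->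
  (hausdorff_raw m.+1 (box a (a + const_mx s)) <= (cube_const * s ^+ m.+1)%:E)%E.
Proof.
move=> s0; pose f (y : V) := s^-1 *: (y - a).
apply: le_trans (@hausdorff_raw_expansion R m _ _ f _ s s0 _) _.
  move=> x y _ _; rewrite /f -scalerBr opprB addrA subrK enormZ gtr0_norm ?invr_gt0//.
  by rewrite mulVKf ?gt_eqF.
rewrite mulrC EFinM -cube_constE; apply: lee_wpmul2l.
  by rewrite lee_fin exprn_ge0// ltW.
apply: le_hausdorff_raw => _ [y ya <-] i; have := ya i; rewrite !mxE.
by rewrite ler_pdivlMl// ler_pdivrMl// mulr0 mulr1 subr_ge0 lerBlDl.
Qed.

Lemma hausdorff_raw_cube_ge (a : V) (s : R) : 0 < s ->
  ((cube_const * s ^+ m.+1)%:E <= hausdorff_raw m.+1 (box a (a + const_mx s)))%E.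
Proof.
move=> s0; pose f (y : V) := a + s *: y.
rewrite mulrC EFinM -cube_constE -lee_pdivlMl ?exprn_gt0// -exprVn.
have si : 0 < s^-1 by rewrite invr_gt0.
apply: le_trans (@hausdorff_raw_expansion R m _ _ f _ s^-1 si _) _.
  move=> x y _ _; rewrite /f opprD addrACA subrr add0r -scalerBr enormZ gtr0_norm//.
  by rewrite mulKf ?gt_eqF.
apply: lee_wpmul2l; first by rewrite lee_fin exprn_ge0// ltW.
apply: le_hausdorff_raw => _ [y ya <-] i; have := ya i; rewrite !mxE => /andP[y0 y1].
by rewrite lerDl mulr_ge0 ?(ltW s0)//= lerD2l -[leRHS]mulr1 ler_wpM2l ?(ltW s0).
Qed.

Lemma hausdorff_raw_le_lebesgue (S : set V) :
  (hausdorff_raw m.+1 S <= cube_const%:E * lebesgue_outer S)%E.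
Proof.
apply: (@outer_measure_le_lebesgue R m (@hausdorff_raw R m.+1 m.+1) _ 1) => //.
- exact: cube_const_gt0.
- by move=> a s /andP[s0 _]; exact: hausdorff_raw_cube_le.
Qed.

Lemma hausdorff_raw_ge_lebesgue (S : set leb) (a : V) (s : R) : 0 < s ->
  measurable S -> S `<=` box a (a + const_mx s) ->
  (cube_const%:E * lebesgue_outer S <= hausdorff_raw m.+1 (S : set V))%E.
Proof.
move=> s0 mS SQ; set Q := box a _ in SQ.
have QE : lebesgue_outer Q = (lebesgue_outer S + lebesgue_outer (Q `\` S))%E.
  by have := mS Q; rewrite setIC (setIidl SQ) -setDE.
have Qvol : lebesgue_outer Q = (s ^+ m.+1)%:E.
  rewrite /Q lebesgue_outer_box ?box_volume_cube// => i.
  by rewrite !mxE lerDl ltW.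
have Dfin : lebesgue_outer (Q `\` S) \is a fin_num.
  rewrite ge0_fin_numE ?lebesgue_outer_ge0//.
  by rewrite (le_lt_trans (le_lebesgue_outer (@subDsetl _ _ _)))// Qvol ltry.
have cDfin : (cube_const%:E * lebesgue_outer (Q `\` S))%E \is a fin_num.
  by rewrite fin_numM.
(* Adding the finite term of the complement of [S] in [Q] leaves a lower bound for the whole cube,
   which scaling provides. *)
rewrite -(leeD2rE _ _ cDfin) -muleDr ?lebesgue_outer_ge0//; last first.
  by rewrite ge0_adde_def// inE lebesgue_outer_ge0.
rewrite -QE Qvol -EFinM.
apply: le_trans (hausdorff_raw_cube_ge a s0) _.
apply: (@le_trans _ _ (hausdorff_raw m.+1 ((S : set V) `|` Q `\` S))).
  by apply: le_hausdorff_raw => x Qx; have [|] := pselect (S x); [left|right].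
apply: le_trans (outer_measureU2 (@hausdorff_raw R m.+1 m.+1) _ _) _.
by apply: leeD => //; exact: hausdorff_raw_le_lebesgue.
Qed.

End hausdorff_vs_lebesgue.

(** * Orthogonal projections *)


Section orthonormal_families.
Context (R : realType) (n : nat).
Local Notation V := 'rV[R]_n.

Definition orthonormal (k : nat) (u : 'I_k -> V) : Prop :=
  forall i j, dotv (u i) (u j) = (i == j)%:R.

Lemma orthonormal_free k (u : 'I_k -> V) :
  orthonormal u -> free [tuple u i | i < k].
Proof.
move=> uo; apply/freeP => c c0 j.
have {}c0 : \sum_(i < k) c i *: u i = 0.
  by rewrite -[RHS]c0; apply: eq_bigr => i _; rewrite -tnth_nth tnth_mktuple.
have := congr1 (fun w => dotv w (u j)) c0.
rewrite dotv0l dotv_suml (bigD1 j)//= big1 ?addr0 => [|i /negbTE ij].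
  by rewrite dotvZl uo eqxx mulr1.
by rewrite dotvZl uo ij mulr0.
Qed.

Definition combine k (u : 'I_k -> V) (t : 'rV[R]_k) : V :=
  \sum_(i < k) t 0 i *: u i.

Lemma combineB k (u : 'I_k -> V) s t :
  combine u (s - t) = combine u s - combine u t.
Proof.
by rewrite /combine -sumrB; apply: eq_bigr => i _; rewrite !mxE scalerBl.
Qed.

Lemma combine_mem k (u : 'I_k -> V) (W : {vspace V}) t :
  (forall i, u i \in W) -> combine u t \in W.
Proof. by move=> uW; apply: memv_suml => i _; exact: memvZ. Qed.

Lemma dotv_combine k (u : 'I_k -> V) t j : orthonormal u ->
  dotv (combine u t) (u j) = t 0 j.
Proof.
move=> uo; rewrite dotv_suml (bigD1 j)//= big1 ?addr0 => [|i /negbTE ij].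
  by rewrite dotvZl uo eqxx mulr1.
by rewrite dotvZl uo ij mulr0.
Qed.

Lemma enorm_combine k (u : 'I_k -> V) t : orthonormal u ->
  enorm (combine u t) = enorm t.
Proof.
move=> uo; congr Num.sqrt; rewrite {2}/combine dotvC dotv_suml.
by apply: eq_bigr => i _; rewrite dotvZl dotvC dotv_combine.
Qed.

Definition coefficients k (u : 'I_k -> V) (x : V) : 'rV[R]_k :=
  \row_i dotv x (u i).

Lemma dotv_residual k (u : 'I_k -> V) x j : orthonormal u ->
  dotv (x - combine u (coefficients u x)) (u j) = 0.
Proof. by move=> uo; rewrite dotvBl dotv_combine// mxE subrr. Qed.

(** Gram-Schmidt: fewer than [\dim W] vectors cannot span [W], so some [w] in [W] leaves a nonzero
    residual to normalize. *)
Lemma exists_orthonormal (W : {vspace V}) k : (k <= \dim W)%N ->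
  exists u : 'I_k -> V, orthonormal u /\ forall i, u i \in W.
Proof.
elim: k => [|k IH] kW; first by exists (fun=> 0); split=> -[].
have [u [uo uW]] := IH (ltnW kW).
have /subvPn[w wW wS] : ~~ (W <= <<[tuple u i | i < k]>>)%VS.
  apply: contraL kW => /dimvS Wk; rewrite -leqNgt (leq_trans Wk)//.
  by rewrite (leq_trans (dim_span _))// size_tuple.
pose v := w - combine u (coefficients u w).
have vW : v \in W by rewrite memvB// combine_mem.
have v0 : enorm v != 0.
  apply: contraNneq wS => /enorm_eq0/subr0_eq ->.
  apply: combine_mem => i; apply: memv_span.
  by apply/tnthP; exists i; rewrite tnth_mktuple.
pose v1 := (enorm v)^-1 *: v.
have v1v1 : dotv v1 v1 = 1.
  by rewrite dotvZl dotvZr -sqr_enorm expr2 mulrA mulrA -mulrA -expr2 -exprMn mulVf// expr1n.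
have v1u i : dotv v1 (u i) = 0 by rewrite dotvZl dotv_residual// mulr0.
exists (fun i => if unlift ord_max i is Some j then u j else v1); split.
  move=> i j; case: (unliftP ord_max i) => [i'|] ->;
    case: (unliftP ord_max j) => [j'|] ->.
  - by rewrite uo (inj_eq (@lift_inj _ _)).
  - by rewrite dotvC v1u eq_sym (negbTE (neq_lift _ _)).
  - by rewrite v1u (negbTE (neq_lift _ _)).
  - by rewrite v1v1 eqxx.
by move=> i; case: unliftP => [j _|_]; rewrite ?uW// memvZ.
Qed.

(** The expansion in an orthonormal basis of [W] is a witness, so [xget] in [orthoproj] does not
    fall back on its default. *)
Lemma orthoproj_spec (W : {vspace V}) (x : V) :
  orthoproj W x \in W /\ forall w, w \in W -> dotv (x - orthoproj W x) w = 0.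
Proof.
have [u [uo uW]] := exists_orthonormal (leqnn (\dim W)).
have bW : basis_of W [tuple u i | i < \dim W].
  rewrite basisEfree orthonormal_free// size_tuple leqnn andbT.
  by apply/span_subvP => _ /tnthP[i ->]; rewrite tnth_mktuple.
apply: (@xgetPex _ 0 [set p | p \in W /\ forall w, w \in W -> dotv (x - p) w = 0]).
exists (combine u (coefficients u x)); split=> [|w wW]; first exact: combine_mem.
rewrite (coord_basis bW wW) dotvC dotv_suml big1// => i _.
by rewrite dotvZl -tnth_nth tnth_mktuple dotvC dotv_residual// mulr0.
Qed.

Lemma orthoproj_mem (W : {vspace V}) x : orthoproj W x \in W.
Proof. by have [] := orthoproj_spec W x. Qed.

Lemma dotv_orthoproj (W : {vspace V}) x w : w \in W ->
  dotv (orthoproj W x) w = dotv x w.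
Proof.
by move=> wW; apply/esym/eqP; rewrite -subr_eq0 -dotvBl; apply/eqP;
  have [_ ->] := orthoproj_spec W x.
Qed.

Lemma orthoproj_uniq (W : {vspace V}) x p : p \in W ->
  (forall w, w \in W -> dotv p w = dotv x w) -> orthoproj W x = p.
Proof.
move=> pW px; apply/subr0_eq/dotvv_eq0.
have dW : orthoproj W x - p \in W by rewrite memvB ?orthoproj_mem.
by rewrite dotvBl dotv_orthoproj// px// subrr.
Qed.

Lemma orthoprojB (W : {vspace V}) x y :
  orthoproj W (x - y) = orthoproj W x - orthoproj W y.
Proof.
apply: orthoproj_uniq => [|w wW]; first by rewrite memvB ?orthoproj_mem.
by rewrite !dotvBl !dotv_orthoproj.
Qed.

Lemma orthoprojZ (W : {vspace V}) a x : orthoproj W (a *: x) = a *: orthoproj W x.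
Proof.
apply: orthoproj_uniq => [|w wW]; first by rewrite memvZ ?orthoproj_mem.
by rewrite !dotvZl !dotv_orthoproj.
Qed.

Lemma orthoproj_id (W : {vspace V}) x : x \in W -> orthoproj W x = x.
Proof. by move=> xW; exact: orthoproj_uniq. Qed.

Lemma enorm_orthoproj (W : {vspace V}) x : enorm (orthoproj W x) <= enorm x.
Proof.
have [->|P0] := eqVneq (enorm (orthoproj W x)) 0; first exact: enorm_ge0.
have {}P0 : 0 < enorm (orthoproj W x) by rewrite lt_neqAle eq_sym P0 enorm_ge0.
rewrite -(ler_pM2r P0) -expr2 sqr_enorm dotv_orthoproj ?orthoproj_mem//.
exact: dotv_le_enorm.
Qed.

Lemma enorm_orthoprojB_le (W1 W2 : {vspace V}) x :
  enorm (orthoproj W1 x - orthoproj W2 x) <= grass_dist W1 W2 * enorm x.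
Proof.
have [/enorm_eq0 ->|x0] := eqVneq (enorm x) 0.
  by rewrite -(scale0r 0) !orthoprojZ !scale0r subrr enorm0 mulr0.
have {}x0 : 0 < enorm x by rewrite lt_neqAle eq_sym x0 enorm_ge0.
rewrite -ler_pdivrMr//; apply: ub_le_sup.
  (* The real [sup] in [opnorm] is known to dominate its set once that set is bounded; both
     projections are contractions, so 2 is a bound. *)
  exists 2 => _ [y y1 <-]; have {}y1 : enorm y <= 1 by move: y1; rewrite /cball/= subr0.
  apply: le_trans (enormD _ _) _; rewrite enormN -[2]/(1 + 1).
  by apply: lerD; apply: le_trans (enorm_orthoproj _ _) _.
exists ((enorm x)^-1 *: x).
  by rewrite /cball/= subr0 enormZ gtr0_norm ?invr_gt0// mulVf// gt_eqF.
by rewrite !orthoprojZ -scalerBr enormZ gtr0_norm ?invr_gt0// mulrC.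
Qed.

End orthonormal_families.

(* Projecting an isometric parametrization of W0 x0 onto W0 x is enough; making
   it isometric again is unnecessary, since a factor 2 per dimension is affordable
   when the ratio is only compared with 2^-n. *)
Lemma local_frame (R : realType) (n m : nat) (A : set 'rV[R]_n)
    (W0 : 'rV[R]_n -> {vspace 'rV[R]_n}) (K : R) (x0 : 'rV[R]_n) :
  (forall x y, A x -> A y -> grass_dist (W0 x) (W0 y) <= K * enorm (x - y)) ->
  grassmannian n m (W0 x0) -> A x0 ->
  (forall x, A x -> K * enorm (x - x0) <= 2^-1) ->
  exists F : 'rV[R]_n -> 'rV[R]_m -> 'rV[R]_n,
  [/\ forall x t, F x t \in W0 x,
      forall x s t, F x (s - t) = F x s - F x t,
      forall x t, enorm (F x t) <= enorm t,
      forall x y t, A x -> A y ->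
        enorm (F x t - F y t) <= K * enorm (x - y) * enorm t &
      forall x t, A x -> enorm t <= 2 * enorm (F x t)].
Proof.
move=> lip dimW Ax0 near.
have [|u [uo uW]] := @exists_orthonormal R n (W0 x0) m; first by rewrite dimW.
exists (fun x t => orthoproj (W0 x) (combine u t)).
have FB x y t : A x -> A y -> enorm (orthoproj (W0 x) (combine u t) -
    orthoproj (W0 y) (combine u t)) <= K * enorm (x - y) * enorm t.
  move=> Ax Ay; apply: le_trans (enorm_orthoprojB_le _ _ _) _.
  by rewrite enorm_combine// ler_wpM2r ?enorm_ge0// lip.
split=> //.
- by move=> x t; exact: orthoproj_mem.
- by move=> x s t; rewrite combineB orthoprojB.
- by move=> x t; rewrite -(enorm_combine t uo) enorm_orthoproj.
(* The projection at [x0] fixes [combine u t], so the one at [x] loses at most half of its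
   length. *)
move=> x t Ax; have := FB x0 x t Ax0 Ax.
rewrite {1}orthoproj_id ?combine_mem// => /(le_trans (enormB _ _)).
rewrite enorm_combine// enorm_sub.
have : K * enorm (x - x0) * enorm t <= 2^-1 * enorm t.
  by rewrite ler_wpM2r ?enorm_ge0// near.
by lra.
Qed.

(** * Points of low density *)


(** Markov's inequality for the measure of the x-sections, then Tonelli to exchange them for the
    y-sections, which are small over [D] and empty off it. *)
Lemma large_xsections (d1 d2 : measure_display) (T1 : measurableType d1)
    (T2 : measurableType d2) (R : realType)
    (m1 : {sigma_finite_measure set T1 -> \bar R})
    (m2 : {sigma_finite_measure set T2 -> \bar R})
    (P : set (T1 * T2)) (D : set T2) (eps lam : R) :
  measurable P -> measurable D -> 0 <= lam -> 0 <= eps ->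
  (forall y, D y -> (m1 (ysection P y) <= eps%:E)%E) ->
  (forall y, ~ D y -> ysection P y = set0) ->
  measurable [set x | (lam%:E <= m2 (xsection P x))%E] /\
  (lam%:E * m1 [set x | lam%:E <= m2 (xsection P x)] <= eps%:E * m2 D)%E.
Proof.
move=> mP mD lam0 eps0 PD PnD; set E := [set x | _].
have mx : measurable_fun setT (m2 \o xsection P) by exact: measurable_fun_xsection.
have my : measurable_fun setT (m1 \o ysection P) by exact: measurable_fun_ysection.
have mE : measurable E.
  by rewrite -[E]setTI; exact: emeasurable_fun_c_infty.
split=> //; rewrite -integral_cst// -integral_cst//.
apply: (@le_trans _ _ (\int[m1]_x (m2 \o xsection P) x)%E).
  apply: (@le_trans _ _ (\int[m1]_(x in E) (m2 \o xsection P) x)%E).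
    by apply: ge0_le_integral => //; exact: measurable_funTS.
  by apply: ge0_subset_integral.
rewrite -(indic_fubini_tonelli_FE m2 mP) indic_fubini_tonelli//.
rewrite (indic_fubini_tonelli_GE m1 mP).
rewrite [leRHS]integral_mkcond; apply: ge0_le_integral => //.
- by apply/(measurable_restrictT _ mD).
- move=> y _; rewrite patchE /=; case: ifPn => [|/negP yD]; first by rewrite inE => /PD.
  by rewrite PnD ?measure0//; move: yD; rewrite inE.
Qed.

(** * Euclidean balls, compactness and product measurability *)

Section enorm_topology.
Context (R : realType).

Lemma open_ball_ex (n : nat) (U : set 'rV[R]_n) :
  (forall x, U x -> exists2 e, 0 < e & ball x e `<=` U) -> open U.
Proof.
by move=> Ue; rewrite openE => x /Ue[e e0 xU]; apply/nbhs_ballP; exists e.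
Qed.

Lemma open_ex_ball (n : nat) (U : set 'rV[R]_n) x : open U -> U x ->
  exists2 e, 0 < e & ball x e `<=` U.
Proof. by rewrite openE => oU /oU/nbhs_ballP. Qed.

Lemma ball_enorm (n : nat) (x y : 'rV[R]_n) (e : R) :
  ball x e y -> enorm (y - x) <= n%:R * e.
Proof.
move=> [e0 xy]; apply: enorm_le_coord => [|i]; first exact: ltW.
by rewrite !mxE distrC; exact: ltW (xy 0 i).
Qed.

Lemma enorm_ball (n : nat) (x y : 'rV[R]_n) (e : R) :
  enorm (y - x) < e -> ball x e y.
Proof.
move=> xy; split=> [|i j]; first exact: le_lt_trans (enorm_ge0 _) xy.
rewrite ord1 /ball/= distrC; apply: le_lt_trans xy.
by have := coord_le_enorm (y - x) j; rewrite !mxE.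
Qed.

Lemma closed_cball (n : nat) (x : 'rV[R]_n.+1) (r : R) : closed (cball x r).
Proof.
rewrite -openC; apply: open_ball_ex => y /negP; rewrite -ltNge => ry.
pose e := (enorm (y - x) - r) / (2 * n.+1%:R).
have n0 : 0 < 2 * n.+1%:R :> R by rewrite mulr_gt0// ltr0n.
have e0 : 0 < e by rewrite divr_gt0// subr_gt0.
exists e => // z /ball_enorm yz; apply/negP; rewrite -ltNge.
have : n.+1%:R * e = (enorm (y - x) - r) / 2.
  by rewrite /e invfM mulrC [X in X * _]mulrA mulfVK// pnatr_eq0.
have := enormD (y - z) (z - x); rewrite addrA subrK (enorm_sub y z).
by move=> ? ?; lra.
Qed.

(** The near-covering form of compactness makes the local choice of a radius uniform, the radius
    being the parameter that tends to 0. *)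
Lemma compact_thickening (n : nat) (G U : set 'rV[R]_n) : compact G -> open U ->
  G `<=` U -> exists2 rho : R, 0 < rho &
    forall x y, G x -> enorm (y - x) < rho -> U y.
Proof.
move=> cG oU GU.
have /compact_near_coveringP/(_ R (nbhs (0 : R))) := cG.
move=> /(_ (fun i x => forall y, enorm (y - x) < i -> U y)).
case.
  move=> x /GU/(open_ex_ball oU)[e e0 xU].
  exists (ball x (e / 2), ball (0 : R) (e / 2)).
    by split; exact: nbhsx_ballx (divr_gt0 _ _).
  move=> [x' i] [/= xx' ie] y yx'; apply: xU.
  rewrite (splitr e); apply: ball_triangle xx' _.
  apply: enorm_ball; apply: lt_trans yx' _.
  by move: ie; rewrite /ball/= sub0r normrN => /(le_lt_trans (ler_norm _)).
move=> e /= e0 Ge; exists (e / 2); first exact: divr_gt0.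
move=> x y Gx; apply: (Ge (e / 2)) => //=.
by rewrite /ball_ sub0r normrN gtr0_norm ?divr_gt0// ltr_pdivrMr// ltr_pMr// ltr1n.
Qed.

End enorm_topology.

Section product_measurability.
Context (R : realType) (n m : nat).
Local Notation Vn := 'rV[R]_n.+1.
Local Notation Vm := 'rV[R]_m.+1.
Local Notation lebn := (caratheodory_type (@lebesgue_outer R n.+1)).
Local Notation lebm := (caratheodory_type (@lebesgue_outer R m.+1)).

Lemma prod_open_measurable (O : set (Vn * Vm)) :
  (forall p, O p -> exists2 e, 0 < e &
     forall q, ball p.1 e q.1 -> ball p.2 e q.2 -> O q) ->
  measurable (O : set (lebn * lebm)).
Proof.
move=> oO; rewrite (_ : O = \bigcup_q (if `[< rat_box q.1 `*` rat_box q.2 `<=` O >]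
    then rat_box q.1 `*` rat_box q.2 else set0)); last first.
  apply/seteqP; split=> [p Op|p [q _]]; last by case: asboolP => // + ?; apply.
  have [e e0 pO] := oO _ Op.
  have [q1 [q1p q1e]] := rat_box_nbhs p.1 e0.
  have [q2 [q2p q2e]] := rat_box_nbhs p.2 e0.
  exists (q1, q2) => //=; rewrite asboolT// => q [/= /q1e ? /q2e ?].
  exact: pO.
apply: countable_bigcupT_measurable => [|q]; first exact: countableP.
by case: asboolP => _ //; apply: measurableX; exact: measurable_rat_box.
Qed.

End product_measurability.


Section unit_ball.
Context (R : realType) (m : nat).
Local Notation Vm := 'rV[R]_m.+1.
Local Notation lebm := (caratheodory_type (@lebesgue_outer R m.+1)).

Lemma cball_subset_cube :
  cball (0 : Vm) 1 `<=` box (const_mx (-1)) (const_mx (-1) + const_mx 2).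
Proof.
move=> t; rewrite /cball/= subr0 => t1 i.
have := le_trans (coord_le_enorm t i) t1.
by rewrite !mxE ler_norml => /andP[? ?]; apply/andP; split; lra.
Qed.

Lemma measurable_cball (x : Vm) r : measurable (cball x r : set lebm).
Proof. exact/closed_lebesgue_measurable/closed_cball. Qed.

Lemma lebesgue_unit_ball : lebesgue_outer (cball (0 : Vm) 1) = (alpha R m.+1)%:E.
Proof.
rewrite /alpha fineK// ge0_fin_numE ?lebesgue_outer_ge0//.
apply: le_lt_trans (le_lebesgue_outer cball_subset_cube) _.
rewrite lebesgue_outer_box ?ltry// => i.
by rewrite !mxE lerDl.
Qed.

Lemma alpha_gt0 : 0 < alpha R m.+1.
Proof.
rewrite -lte_fin -lebesgue_unit_ball.
(* A cube of this side has Euclidean diameter at most 1, so with a corner at 0 it lies in the unit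
   ball. *)
have s0 : 0 < m.+1%:R^-1 :> R by rewrite invr_gt0 ltr0n.
apply: (@lt_le_trans _ _ (lebesgue_outer
    (box (0 : Vm) (0 + const_mx m.+1%:R^-1)))).
  rewrite lebesgue_outer_box ?box_volume_cube ?lte_fin ?exprn_gt0// => i.
  by rewrite !mxE add0r ltW.
apply: le_lebesgue_outer => t t0; rewrite /cball/=.
have z0 : box (0 : Vm) (0 + const_mx m.+1%:R^-1) 0.
  by move=> i; rewrite !mxE lexx add0r ltW.
by apply: le_trans (enorm_cube t0 z0) _; rewrite mulfV// pnatr_eq0.
Qed.

End unit_ball.

(** * Return to the closed set at one scale *)

Section one_scale.
Context (R : realType) (n m : nat).
Local Notation Vn := 'rV[R]_n.+1.
Local Notation Vm := 'rV[R]_m.+1.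
Local Notation lebn := (caratheodory_type (@lebesgue_outer R n.+1)).
Local Notation lebm := (caratheodory_type (@lebesgue_outer R m.+1)).
Variables (G : set Vn) (F : Vn -> Vm -> Vn) (K r : R).
Hypotheses (closedG : closed G) (K0 : 0 < K) (r0 : 0 < r) (rK : r * K <= 2^-1).
Hypothesis FB : forall x s t, F x (s - t) = F x s - F x t.
Hypothesis F_le : forall x t, enorm (F x t) <= enorm t.
Hypothesis F_lip : forall x y t, G x -> G y ->
  enorm (F x t - F y t) <= K * enorm (x - y) * enorm t.

Let Phi (t : Vm) (x : Vn) : Vn := x + r *: F x t.

(** Additivity of [F] in the parameter separates the change of base point from that of parameter.
    Equal parameters give [Phi_expansion]; the general case is the joint continuity behind
    [measurable_escaping]. *)
Let Phi_lip (x y : Vn) (s t : Vm) : G x -> G y -> enorm s <= 1 ->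
  enorm (Phi s x - Phi t y - (x - y)) <= 2^-1 * enorm (x - y) + r * enorm (s - t).
Proof.
move=> Gx Gy s1.
have -> : Phi s x - Phi t y - (x - y) = r *: ((F x s - F y s) + F y (s - t)).
  rewrite FB addrA subrK scalerBr /Phi opprD addrACA [_ + _ - (x - y)]addrC addrA.
  by rewrite addNr add0r.
rewrite enormZ gtr0_norm//.
have h1 := F_lip s Gx Gy; have h2 := F_le y (s - t).
have h3 := enormD (F x s - F y s) (F y (s - t)).
have h4 : enorm (F x s - F y s) <= K * enorm (x - y).
  apply: le_trans h1 _; rewrite -[leRHS]mulr1 ler_wpM2l//.
  by rewrite mulr_ge0 ?enorm_ge0// ltW.
have h5 : r * enorm (F x s - F y s + F y (s - t)) <=
    r * (K * enorm (x - y) + enorm (s - t)).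
  by rewrite ler_pM2l//; lra.
apply: le_trans h5 _; rewrite mulrDr lerD2r mulrA.
by rewrite ler_wpM2r ?enorm_ge0.
Qed.

Let Phi_expansion (t : Vm) x y : enorm t <= 1 -> G x -> G y ->
  enorm (x - y) <= 2 * enorm (Phi t x - Phi t y).
Proof.
move=> t1 Gx Gy; have := Phi_lip t Gx Gy t1.
rewrite subrr enorm0 mulr0 addr0 enorm_sub => h.
by have := enormB (x - y) (Phi t x - Phi t y); lra.
Qed.

Definition escaping : set (Vn * Vm) :=
  [set p | [/\ G p.1, enorm p.2 <= 1 & ~ G (p.1 + r *: F p.1 p.2)]].

(** Escaping is a relatively open condition, since the complement of [G] is open. As [F_lip] speaks
    only about points of [G], the open set [O] imposes its condition only on nearby pairs in [G]
    times the ball. *)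
Lemma measurable_escaping : measurable (escaping : set (lebn * lebm)).
Proof.
pose O : set (Vn * Vm) := [set p | exists2 e, 0 < e &
  forall q, ball p.1 e q.1 -> ball p.2 e q.2 -> G q.1 -> enorm q.2 <= 1 ->
    ~ G (Phi q.2 q.1)].
rewrite (_ : escaping = (G `*` cball 0 1) `&` O).
  apply: measurableI.
    apply: measurableX; last exact: measurable_cball.
    exact: closed_lebesgue_measurable.
  apply: prod_open_measurable => p [e e0 pO].
  exists (e / 2) => [|q q1 q2]; first exact: divr_gt0.
  exists (e / 2) => [|q' q'1 q'2]; first exact: divr_gt0.
  by apply: pO; rewrite (splitr e); apply: ball_triangle; eassumption.
apply/seteqP; split=> [p [Gp p1 nG]|p [[Gp p1] [e e0 pO]]]; last first.
  move: p1; rewrite /cball/= subr0 => p1.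
  by split=> //; apply: pO => //; exact: ballxx.
split; first by split=> //; rewrite /cball/= subr0.
have [d d0 dG] := open_ex_ball (closed_openC closedG) nG.
(* A change of both arguments by [e] in the sup norm moves [Phi] by at most [c * e]; the 2 exceeds
   the Lipschitz constant 3/2 in the base point. *)
pose c : R := 2 * n.+1%:R + r * m.+1%:R.
have c0 : 0 < c by rewrite addr_gt0// mulr_gt0// ltr0n.
exists (d / (2 * c)) => [|q q1 q2 Gq qle1]; first by rewrite divr_gt0// mulr_gt0.
apply: dG; apply: enorm_ball.
have h := Phi_lip p.2 Gq Gp qle1.
have h1 := ball_enorm q1; have h2 := ball_enorm q2.
have h3 := enormD (Phi q.2 q.1 - Phi p.2 p.1 - (q.1 - p.1)) (q.1 - p.1).
rewrite subrK in h3; rewrite -/(Phi p.2 p.1).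
have h6 := enorm_ge0 (q.1 - p.1).
set e := d / _ in h1 h2.
have ec : c * e = d / 2 by rewrite /e; field; rewrite gt_eqF.
have h4 : r * enorm (q.2 - p.2) <= r * (m.+1%:R * e) by rewrite ler_pM2l.
have h5 : c * e = 2 * (n.+1%:R * e) + r * (m.+1%:R * e).
  by rewrite /c mulrDl !mulrA.
by lra.
Qed.

Variables (U : set Vn) (eps : R).
Hypotheses (eps0 : 0 <= eps) (GU : forall x t, G x -> enorm t <= 1 -> U (Phi t x)).
Hypothesis Ueps : (lebesgue_outer (U `\` G) <= eps%:E)%E.

(* The factor of lebesgue_outer_expansion for the map Phi t on G. *)
Definition scale_const : R := (2 * (2 * n.+1%:R)) ^+ n.+1.

Lemma scale_const_gt0 : 0 < scale_const.
Proof. by rewrite exprn_gt0// !mulr_gt0// ltr0n. Qed.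

(** [E] collects the points for which the escaping parameters have measure at least [alpha / 2]; the
    factor 2 is [alpha] over this Markov threshold. *)
Lemma most_points_return :
  exists E : set Vn, (lebesgue_outer E <= (2 * (scale_const * eps))%:E)%E /\
    forall x, G x -> ~ E x ->
    ((alpha R m.+1 / 2)%R%:E <=
      lebesgue_outer [set t : Vm | (enorm t <= 1)%R /\ G (x + r *: F x t)%R])%E.
Proof.
have a0 := alpha_gt0 R m.
have C0 : 0 <= scale_const * eps by rewrite mulr_ge0// ltW// scale_const_gt0.
have sec t : cball 0 1 t ->
    (lebesgue_outer (ysection escaping t) <= (scale_const * eps)%:E)%E.
  rewrite /cball/= subr0 => t1.
  (* Escaping points land in [U] outside [G], a set of measure at most [eps], and the expansion
     bound controls its preimage. *)
  apply: (@le_trans _ _ (lebesgue_outer (G `&` Phi t @^-1` (U `\` G)))).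
    apply: le_lebesgue_outer => x; rewrite /ysection/= inE => -[/= Gx _ nG].
    by split=> //; split=> //; exact: GU.
  apply: le_trans (lebesgue_outer_expansion (Lam := 2) _ _ _) _ => //.
    by move=> x y Gx Gy; exact: Phi_expansion.
  rewrite -/scale_const EFinM; apply: lee_wpmul2l => //.
  by rewrite lee_fin ltW// scale_const_gt0.
have nsec t : ~ cball 0 1 t -> ysection escaping t = set0.
  move=> nt; rewrite -subset0 => x; rewrite /ysection/= inE => -[/= _ t1 _].
  by apply: nt; rewrite /cball/= subr0.
have a20 : 0 < alpha R m.+1 / 2 by rewrite divr_gt0.
have [mE Ele] := @large_xsections _ _ lebn lebm R (@lebesgue_outer R n.+1)
  (@lebesgue_outer R m.+1) escaping (cball 0 1) _ _ measurable_escaping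
  (measurable_cball _ _) (ltW a20) C0 sec nsec.
set E := [set x | _] in mE Ele.
exists E; split.
  move: Ele; rewrite [X in (_ <= _ * X)%E]lebesgue_unit_ball -EFinM.
  rewrite -lee_pdivlMl// -EFinM => /le_trans; apply; rewrite lee_fin.
  rewrite le_eqVlt; apply/orP; left; apply/eqP; field; lra.
move=> x Gx /negP; rewrite -ltNge => xE.
set S := [set t | _].
(* Each parameter in the ball returns to [G] or escapes, and those that escape have measure below
   [alpha / 2]. *)
have : (lebesgue_outer (cball (0 : Vm) 1) <=
    lebesgue_outer S + lebesgue_outer (xsection escaping x))%E.
  apply: le_trans (outer_measureU2 (@lebesgue_outer R m.+1) _ _).
  apply: le_lebesgue_outer => t; rewrite /cball/= subr0 => t1.
  have [Gt|nGt] := pselect (G (x + r *: F x t)); [left|right]; first by split.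
  by rewrite /xsection/= inE; split.
rewrite lebesgue_unit_ball => Sa.
have : ((alpha R m.+1)%:E <= lebesgue_outer S + (alpha R m.+1 / 2)%:E)%E.
  by apply: le_trans Sa _; apply: leeD2l; exact: ltW.
by rewrite -leeBlDr// -EFinB [X in X - _]splitr addrK.
Qed.

Variables (A : set Vn) (W : {vspace Vn}) (x : Vn).
Hypothesis mn : (m < n)%N.
Hypotheses (GA : G `<=` A) (FW : forall t, F x t \in W).
Hypothesis F_ge : forall t, enorm t <= 2 * enorm (F x t).

Lemma ratio_ge :
  ((alpha R m.+1 / 2)%R%:E <=
    lebesgue_outer [set t : Vm | (enorm t <= 1)%R /\ G (x + r *: F x t)%R])%E ->
  (((2 ^+ n.+1)^-1)%:E <=
    hausdorff m.+1 (A `&` cball x r `&` affine_subspace x W)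
      * ((alpha R m.+1 * r ^+ m.+1)^-1)%R%:E)%E.
Proof.
set S := [set t | _] => aS.
have a0 := alpha_gt0 R m; have c0 := cube_const_gt0 R m.
(* The lower bound [hausdorff_raw_ge_lebesgue] works through complements and asks for
   measurability. *)
have mS : measurable (S : set lebm).
  apply: closed_lebesgue_measurable.
  rewrite (_ : S = cball 0 1 `&` [set t | G (Phi t x)]); last first.
    by apply/seteqP; split=> t; rewrite /cball/= subr0.
  apply: closedI; first exact: closed_cball.
  rewrite -openC; apply: open_ball_ex => t nG.
  have [d d0 dG] := open_ex_ball (closed_openC closedG) nG.
  have rm0 : 0 < r * m.+1%:R * 2 by rewrite !mulr_gt0// ltr0n.
  exists (d / (r * m.+1%:R * 2)) => [|s /ball_enorm ts]; first exact: divr_gt0.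
  apply: dG; apply: enorm_ball.
  rewrite /Phi opprD addrACA subrr add0r -scalerBr -FB enormZ gtr0_norm//.
  apply: (@le_lt_trans _ _ (r * (m.+1%:R * (d / (r * m.+1%:R * 2))))).
    by rewrite ler_pM2l//; exact: le_trans (F_le _ _) ts.
  have -> : r * (m.+1%:R * (d / (r * m.+1%:R * 2))) = d / 2.
    by field; rewrite !gt_eqF// ltr0n.
  by rewrite ltr_pdivrMr// ltr_pMr// ltr1n.
have SQ : S `<=` box (const_mx (-1)) (const_mx (-1) + const_mx 2).
  move=> t [t1 _]; apply: cball_subset_cube.
  by rewrite /cball/= subr0.
(* The inverse of [t] to [Phi t x] has Lipschitz constant [2 / r]: 2 from [F_ge], [1 / r] from the
   scale. *)
have r20 : 0 < 2 / r by rewrite divr_gt0.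
have raw_ge : ((cube_const R m * (alpha R m.+1 / 2))%:E <= ((2 / r) ^+ m.+1)%:E *
    hausdorff_raw m.+1 (A `&` cball x r `&` affine_subspace x W))%E.
  apply: (@le_trans _ _ (hausdorff_raw m.+1 S)).
    apply: le_trans (hausdorff_raw_ge_lebesgue (ltr0Sn R 1) mS SQ).
    by rewrite EFinM; apply: lee_wpmul2l => //; rewrite lee_fin ltW.
  apply: le_trans (@hausdorff_raw_expansion R m _ _ (fun t => Phi t x) S _ r20 _) _.
    move=> s t _ _; rewrite /Phi opprD addrACA subrr add0r -scalerBr -FB.
    by rewrite enormZ gtr0_norm// mulrA divfK ?gt_eqF.
  apply: lee_wpmul2l; first by rewrite lee_fin exprn_ge0// ltW.
  apply: le_hausdorff_raw => _ [t [t1 Gt] <-]; split; last first.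
    by exists (r *: F x t) => //=; exact: memvZ.
  split; first exact: GA.
  rewrite /cball/= /Phi addrAC subrr add0r enormZ gtr0_norm//.
  by rewrite -[leRHS]mulr1 ler_pM2l// (le_trans (F_le _ _)).
rewrite /hausdorff /hausdorff_const -/(cube_const R m).
rewrite -lee_pdivrMl ?exprn_gt0// -EFinM in raw_ge.
rewrite muleAC -EFinM.
apply: (@le_trans _ _ ((((cube_const R m)^-1 * (alpha R m.+1 * r ^+ m.+1)^-1)%R%:E *
  (((2 / r) ^+ m.+1)^-1 * (cube_const R m * (alpha R m.+1 / 2)))%:E)%E)); last first.
  apply: lee_wpmul2l raw_ge; rewrite lee_fin mulr_ge0// invr_ge0 ltW//.
  by rewrite mulr_gt0// exprn_gt0.
rewrite -EFinM lee_fin.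
(* [cube_const], [alpha] and [r] cancel. What is left is [m.+1] halves from the distortion and one
   from the threshold [alpha / 2], and [mn] gives [m.+2 <= n.+1]. *)
rewrite [leRHS](_ : _ = (2 ^+ m.+2)^-1); last first.
  have p0 : 0 < r ^+ m.+1 by rewrite exprn_gt0.
  have q0 : 0 < 2 ^+ m.+1 :> R by rewrite exprn_gt0.
  rewrite expr_div_n [in RHS]exprS; move: (r ^+ m.+1) (2 ^+ m.+1) p0 q0 => p q p0 q0.
  by field; rewrite !gt_eqF.
by rewrite lef_pV2 ?posrE ?exprn_gt0// ler_weXn2l ?ler1n.
Qed.

End one_scale.


Lemma lebesgue_outer_eps0 (R : realType) (n : nat) (S : set 'rV[R]_n.+1) :
  (forall e : R, 0 < e -> (lebesgue_outer S <= e%:E)%E) -> lebesgue_outer S = 0%E.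
Proof.
move=> Se; apply/eqP; rewrite eq_le lebesgue_outer_ge0 andbT.
by apply/lee_addgt0Pr => e e0; rewrite add0e; exact: Se.
Qed.

Lemma lebesgue_outer_countable0 (R : realType) (n : nat) (I : countType)
    (F : I -> set 'rV[R]_n.+1) : (forall i, lebesgue_outer (F i) = 0%E) ->
  lebesgue_outer (\bigcup_i F i) = 0%E.
Proof.
move=> F0; pose F' k := if unpickle k is Some i then F i else set0.
apply/eqP; rewrite eq_le lebesgue_outer_ge0 andbT.
apply: (@le_trans _ _ (lebesgue_outer (\bigcup_k F' k))).
  by apply: le_lebesgue_outer => x [i _ Fix]; exists (pickle i) => //; rewrite /F' pickleK.
apply: le_trans (lebesgue_outer_sigma_subadditive _) _.
by rewrite eseries0// => k _ _; rewrite /F'; case: unpickle => // _.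
Qed.

(** * The points of low density form a null set *)

Section density.
Context (R : realType) (n m : nat).
Local Notation Vn := 'rV[R]_n.+1.
Variables (A : set Vn) (W0 : Vn -> {vspace Vn}).
Hypothesis mn : (m < n)%N.

Definition density_ratio (x : Vn) (r : R) : \bar R :=
  (hausdorff m.+1 (A `&` cball x r `&` affine_subspace x (W0 x))
    * ((alpha R m.+1 * r ^+ m.+1)^-1)%:E)%E.

Definition sparse : set Vn :=
  [set x | A x /\ ~ (((2 ^+ n.+1)^-1)%:E <= limf_esup (density_ratio x) 0^'+)%E].

(** One threshold for all its points, so that a single scale [r] can test them together. *)
Definition sparse_below (j : nat) : set Vn :=
  [set x | forall r, 0 < r < j.+1%:R^-1 ->
    (density_ratio x r < ((2 ^+ n.+1)^-1)%:E)%E].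

Lemma sparse_subset : sparse `<=` \bigcup_j sparse_below j.
Proof.
move=> x [Ax /negP]; rewrite -ltNge limf_esupE => /ereal_inf_lt[_ [V V0 <-]].
move=> supV; have /nbhs_ballP[e /= e0 eV] := V0.
(* With this [j], [j.+1] exceeds [1 / e], so every positive radius below its inverse lies in [V]. *)
exists (Num.truncn e^-1) => // r /andP[r0 re].
apply: le_lt_trans supV; apply: ereal_sup_ubound; exists r => //.
apply: eV => //; rewrite /ball/= sub0r normrN gtr0_norm//.
apply: lt_le_trans re _; rewrite -[leRHS]invrK lef_pV2 ?posrE ?invr_gt0 ?ltr0n//.
exact: ltW (truncnS_gt _).
Qed.

Variables (G : set Vn) (F : Vn -> 'rV[R]_m.+1 -> Vn) (K : R).
Hypotheses (closedG : closed G) (compactG : compact G) (K0 : 0 < K) (GA : G `<=` A).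
Hypothesis Gfin : (lebesgue_outer G < +oo)%E.
Hypothesis FW : forall x t, F x t \in W0 x.
Hypothesis FB : forall x s t, F x (s - t) = F x s - F x t.
Hypothesis F_le : forall x t, enorm (F x t) <= enorm t.
Hypothesis F_lip : forall x y t, G x -> G y ->
  enorm (F x t - F y t) <= K * enorm (x - y) * enorm t.
Hypothesis F_ge : forall x t, G x -> enorm t <= 2 * enorm (F x t).

Lemma sparse_below_null j : lebesgue_outer (G `&` sparse_below j) = 0%E.
Proof.
apply: lebesgue_outer_eps0 => e e0.
have C0 := scale_const_gt0 R n.
(* Makes the bound of [most_points_return] on the exceptional set equal to [e]. *)
pose d := e / (2 * scale_const R n).
have d0 : 0 < d by rewrite divr_gt0// mulr_gt0.
have mG := closed_lebesgue_measurable closedG.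
have [U [oU GU Ud]] := lebesgue_outer_regular mG Gfin d0.
have [rho rho0 GrU] := compact_thickening compactG oU GU.
(* The three terms keep [Phi] inside [U], make it a 1/2-Lipschitz perturbation of the identity, and
   put [r] in the range of [sparse_below j]; [rho / 2] and [j.+2] make the inequalities strict. *)
pose r := Num.min (rho / 2) (Num.min (2 * K)^-1 (j.+2%:R)^-1).
have r0 : 0 < r by rewrite !lt_min !invr_gt0 divr_gt0// mulr_gt0// ltr0n.
have r_rho : r < rho.
  by apply: (@le_lt_trans _ _ (rho / 2)); [rewrite ge_min lexx|lra].
have rK : r * K <= 2^-1.
  rewrite -ler_pdivlMr// -invfM; by rewrite !ge_min lexx ?orbT.
have rj : r < j.+1%:R^-1.
  apply: (@le_lt_trans _ _ (j.+2%:R)^-1); first by rewrite !ge_min lexx ?orbT.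
  by rewrite ltf_pV2 ?posrE ?ltr0n// ltr_nat.
have PhiU x t : G x -> enorm t <= 1 -> U (x + r *: F x t).
  move=> Gx t1; apply: (GrU x) => //.
  rewrite addrAC subrr add0r enormZ gtr0_norm//; apply: le_lt_trans r_rho.
  by rewrite -[leRHS]mulr1 ler_pM2l// (le_trans (F_le _ _)).
have [E [LE GE]] := most_points_return closedG K0 r0 rK FB F_le F_lip
  (ltW d0) PhiU Ud.
apply: (@le_trans _ _ (lebesgue_outer E)).
  apply: le_lebesgue_outer => x [Gx xj]; apply: contrapT => nE.
  have := ratio_ge closedG r0 FB F_le mn GA (FW x) (fun t => F_ge t Gx) (GE x Gx nE).
  by rewrite leNgt xj// r0.
apply: le_trans LE _; rewrite lee_fin le_eqVlt; apply/orP; left; apply/eqP.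
by rewrite /d; field; rewrite gt_eqF.
Qed.

Lemma sparse_compact_null : lebesgue_outer (G `&` sparse) = 0%E.
Proof.
have := lebesgue_outer_countable0 sparse_below_null.
rewrite -setI_bigcupr => G0; apply/eqP; rewrite eq_le lebesgue_outer_ge0 andbT.
by rewrite -G0; apply: le_lebesgue_outer; apply: setIS; exact: sparse_subset.
Qed.

End density.

Lemma sparse_null (R : realType) (n m : nat) (A : set 'rV[R]_n.+1)
    (W0 : 'rV[R]_n.+1 -> {vspace 'rV[R]_n.+1}) : (m < n)%N -> borel A ->
  (forall x, A x -> grassmannian n.+1 m.+1 (W0 x)) -> grass_lipschitz A W0 ->
  lebesgue_outer (sparse m A W0) = 0%E.
Proof.
move=> mn bA dimW [K' lip'].
pose K := Num.max K' 1.
have K0 : 0 < K by rewrite lt_max ltr01 orbT.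
have lip x y : A x -> A y -> grass_dist (W0 x) (W0 y) <= K * enorm (x - y).
  move=> Ax Ay; apply: le_trans (lip' _ _ Ax Ay) _.
  by rewrite ler_wpM2r ?enorm_ge0// le_max lexx.
(* Cubes of this side have Euclidean diameter at most [(2 * K)^-1], so the planes at two points of
   [A] in one cube are within 1/2 of each other. *)
pose s : R := (2 * K * n.+1%:R)^-1.
have s0 : 0 < s by rewrite invr_gt0 !mulr_gt0// ltr0n.
pose corner (k : 'rV[int]_n.+1) : 'rV[R]_n.+1 := \row_i (s * (k 0 i)%:~R).
pose cube k := box (corner k) (corner k + const_mx s).
have cube_cover : [set: 'rV[R]_n.+1] `<=` \bigcup_k cube k.
  move=> x _; exists (\row_i Num.floor (x 0 i / s)) => // i; rewrite !mxE.
  have := floor_itv (x 0 i / s); rewrite intrD => /andP[].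
  rewrite ler_pdivlMr// ltr_pdivrMr// mulrDl mul1r => kx xk.
  by apply/andP; split; lra.
suff cube0 k : lebesgue_outer (cube k `&` sparse m A W0) = 0%E.
  have := lebesgue_outer_countable0 cube0; rewrite -setI_bigcupl => L0.
  apply/eqP; rewrite eq_le lebesgue_outer_ge0 andbT -L0.
  by apply: le_lebesgue_outer => x xS; split=> //; exact: cube_cover.
(* Dimension and Lipschitz bound of [W0] are given over [A], so the reference point of the frame is
   taken in [A]. *)
have [Q0|/set0P[x0 [Ax0 Qx0]]] := eqVneq (A `&` cube k) set0.
  rewrite (_ : _ `&` _ = set0) ?lebesgue_outer_set0// -subset0 => x [Qx [Ax _]].
  by rewrite -Q0.
pose AQ := A `&` cube k.
have lipQ x y : AQ x -> AQ y -> grass_dist (W0 x) (W0 y) <= K * enorm (x - y).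
  by move=> [Ax _] [Ay _]; exact: lip.
have near0 x : AQ x -> K * enorm (x - x0) <= 2^-1.
  move=> [_ Qx]; apply: (@le_trans _ _ (K * (n.+1%:R * s))).
    by rewrite ler_pM2l//; exact: enorm_cube Qx Qx0.
  have N0 : 0 < n.+1%:R :> R by rewrite ltr0n.
  rewrite le_eqVlt; apply/orP; left; apply/eqP; rewrite /s.
  by move: n.+1%:R N0 => N N0; field; rewrite !gt_eqF.
have [F [FW FB F_le F_lip F_ge]] := local_frame lipQ (dimW _ Ax0) (conj Ax0 Qx0) near0.
have corner_le i : corner k 0 i <= (corner k + const_mx s) 0 i.
  by rewrite !mxE lerDl ltW.
apply: lebesgue_outer_eps0 => e e0.
have [G [closedG GAQ Ge]] :=
  lebesgue_inner_regular (borel_lebesgue_measurable bA) corner_le e0.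
have compactG : compact G.
  apply: bounded_closed_compact => //.
  have [M [Mreal QM]] := bounded_box (corner k) (corner k + const_mx s).
  by exists M; split=> // M' /QM QM' x /GAQ[_]; exact: QM'.
have Gfin : (lebesgue_outer G < +oo)%E.
  apply: (@le_lt_trans _ _ (lebesgue_outer (cube k))).
    by apply: le_lebesgue_outer => x /GAQ[].
  by rewrite lebesgue_outer_box ?ltry.
have GA : G `<=` A by move=> x /GAQ[].
have G0 : lebesgue_outer (G `&` sparse m A W0) = 0%E.
  apply: (@sparse_compact_null R n m A W0 mn G F K) => //.
  - by move=> x y t /GAQ Gx /GAQ Gy; exact: F_lip.
  - by move=> x t /GAQ Gx; exact: F_ge.
(* Sparse points of the cube outside [G] lie in the part of [A] lost to inner regularity, of measure
   at most [e]. *)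
apply: (@le_trans _ _ (lebesgue_outer (G `&` sparse m A W0) +
                       lebesgue_outer ((A `&` cube k) `\` G))%E).
  apply: le_trans (outer_measureU2 (@lebesgue_outer R n.+1) _ _).
  apply: le_lebesgue_outer => x [Qx Sx].
  have [Gx|nG] := pselect (G x); [by left|right].
  by split=> //; case: Sx.
by rewrite G0 add0e.
Qed.

Theorem theorem8p4 (R : realType) (n m : nat)
  (hm : (1 <= m)%N) (hmn : (m <= n - 1)%N)
  (A : set 'rV[R]_n) (hA : borel A)
  (W0 : 'rV[R]_n -> {vspace 'rV[R]_n})
  (hW0 : forall x, A x -> grassmannian n m (W0 x))
  (hLip : grass_lipschitz A W0) :
  lebesgue_outer
    [set x | A x /\
       ~ (((2 ^+ n)^-1)%:E <=
            limf_esup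
              (fun r : R =>
                 hausdorff m (A `&` cball x r `&` affine_subspace x (W0 x))
                   * ((alpha R m * r ^+ m)^-1)%:E)
              0^'+)%E] = 0%E.
Proof.
case: m => [//|m] in hm hmn hW0 *; case: n => [//|n] in hmn A hA W0 hW0 hLip *.
by apply: sparse_null => //; rewrite subn1 in hmn.
Qed.
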